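(* Consider the fixed-design linear model, estimators and assumptions described in the context. (1) If Assumptions 1–5 hold, then $$\mathrm{Prob}\big(\widehat{\mathcal N}_{b_n}\neq \mathcal N_{b_n}\big)=O\big(n^{\alpha_p+m\nu_b-m\eta}\big)\quad\text{and}\quad \max_{i=1,\dots,p_1}|\widehat\gamma_i-\gamma_i| = O_p\big(|\mathcal M|^{1/m}\, n^{-\eta}\big).$$ (2) If Assumptions 1–6 hold, then $|\widehat\sigma^2-\sigma^2| = O_p(n^{-\alpha_\sigma})$.
   Context: Model: $y=X\beta+\epsilon$, $y\in\mathbb R^n$, with deterministic $n\times p$ design matrix $X=(x_{ij})$ of rank $r$, unknown $\beta\in\mathbb R^p$, errors $\epsilon=(\epsilon_1,\dots,\epsilon_n)^T$. All quantities ($p,r,X,\beta,M,p_1,\rho_n,b_n,\dots$) may depend on $n$; all asymptotic statements are as $n\to\infty$. $M=(m_{ij})$ is a known $p_1\times p$ matrix and $\gamma=(\gamma_1,\dots,\gamma_{p_1})^T=M\beta$. Let $X=P\Lambda Q^T$ be a thin SVD: $P=(p_{lk})$ is $n\times r$, $Q=(q_{jk})$ is $p\times r$, $P^TP=Q^TQ=I_r$, $\Lambda=\mathrm{diag}(\lambda_1,\dots,\lambda_r)$ with $\lambda_1\ge\dots\ge\lambda_r>0$. Let $Q_\perp$ be a $p\times(p-r)$ matrix with $Q_\perp^TQ_\perp=I_{p-r}$, $Q^TQ_\perp=0$, $QQ^T+Q_\perp Q_\perp^T=I_p$. Set $\zeta=Q^T\beta$, $\theta=(\theta_1,\dots,\theta_p)^T=QQ^T\beta$,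 $\theta_\perp=(\theta_{\perp,1},\dots,\theta_{\perp,p})^T=Q_\perp Q_\perp^T\beta$ (with $\theta_\perp=0$ if $r=p$). Given a ridge parameter $\rho_n>0$ and threshold $b_n>0$, let $\mathcal N_{b_n}=\{i:|\theta_i|>b_n\}$, $c_{ik}=\sum_{j\in\mathcal N_{b_n}}m_{ij}q_{jk}$ ($i\le p_1,k\le r$), $\mathcal M=\{i:\sum_{k=1}^r c_{ik}^2>0\}$, $w_k=\frac{\lambda_k}{\lambda_k^2+\rho_n}+\frac{\rho_n\lambda_k}{(\lambda_k^2+\rho_n)^2}$, $\tau_i=\sqrt{\sum_{k=1}^r c_{ik}^2w_k^2+1/n}$. Estimators: $\widetilde\theta^\star=(X^TX+\rho_nI_p)^{-1}X^Ty$, $\widetilde\theta=(\widetilde\theta_1,\dots,\widetilde\theta_p)^T=\widetilde\theta^\star+\rho_nQ(\Lambda^2+\rho_nI_r)^{-1}Q^T\widetilde\theta^\star$, $\widehat{\mathcal N}_{b_n}=\{i:|\widetilde\theta_i|>b_n\}$, $\widehat\theta_i=\widetilde\theta_i\mathbf 1_{i\in\widehat{\mathcal N}_{b_n}}$, $\widehat\gamma=M\widehat\theta$, $\widehat\sigma^2=\frac1n\sum_{i=1}^n(y_i-\sum_{j=1}^px_{ij}\widehat\theta_j)^2$, and $\sigma^2=\mathbf E\epsilon_1^2$. Assumption 1: $X$ is deterministic; there are constants $c_\lambda,C_\lambda>0$, $0<\eta\le1/2$ with $C_\lambda n^{1/2}\ge\lambda_1\ge\dots\ge\lambda_r\ge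 c_\lambda n^{\eta}$; and $\|\theta\|_2=O(n^{\alpha_\theta})$ with $0<\alpha_\theta<3\eta$. Assumption 2: $\rho_n=O(n^{2\eta-\delta})$ for a constant $\delta$ with $\frac{\eta+\alpha_\theta}{2}<\delta<2\eta$. Assumption 3: $\epsilon_1,\dots,\epsilon_n$ are i.i.d., $\mathbf E\epsilon_1=0$, $\mathbf E|\epsilon_1|^m<\infty$ for some $m>4$. Assumption 4: $p=O(n^{\alpha_p})$ with $\alpha_p\in[0,m\eta)$; $b_n=C_bn^{-\nu_b}$ with constants $C_b,\nu_b>0$ and $\nu_b+\alpha_p/m-\eta<0$; there is a constant $0<c_b<1$ with $\max_{i\notin\mathcal N_{b_n}}|\theta_i|\le c_bb_n$ and $\min_{i\in\mathcal N_{b_n}}|\theta_i|\ge b_n/c_b$. Assumption 5: $\mathcal M\neq\emptyset$, $|\mathcal M|=O(n^{\alpha_{\mathcal M}})$ with $\alpha_{\mathcal M}<m\eta$; there are constants with $0<c_{\mathcal M}<\sum_{k=1}^rc_{ik}^2\le C_{\mathcal M}$ for all $i\in\mathcal M$; and $\max_{i\le p_1}|\sum_{j\notin\mathcal N_{b_n}}m_{ij}\theta_j|=o(1/\sqrt{n\log n})$, $\max_{i\le p_1}|\sum_{j=1}^pm_{ij}\theta_{\perp,j}|=o(1/\sqrt{n\log n})$. Assumption 6: there is a constant $0<\alpha_\sigma\le\eta$ with $n^{-\nu_b}\sum_{j\notin\mathcal N_{b_n}}|\theta_j|=O(n^{-\alpha_\sigma})$ and $\sqrt{|\mathcal N_{b_n}|}/n^{\eta}=O(n^{-\alpha_\sigma})$.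 *)

(* Defs.v *)
From HB Require Import structures.
From mathcomp Require Import all_boot all_order all_algebra.
From mathcomp Require Import all_classical all_reals all_analysis.

Set Warnings "-notation-overridden,-ambiguous-paths,-notation-incompatible-prefix".
Set Implicit Arguments.
Unset Strict Implicit.
Unset Printing Implicit Defensive.

Import Order.TTheory GRing.Theory Num.Theory.
Local Open Scope ring_scope.

Definition eventually_nat (Q : nat -> Prop) : Prop :=
  exists N : nat, forall n : nat, (N <= n)%N -> Q n.

(* n^a for real a (n >= 1 in all uses) *)
Definition npow {R : realType} (n : nat) (a : R) : R := (n%:R) `^ a.

Definition bigO_seq {R : realType} (x a : nat -> R) : Prop :=
  exists C : R, 0 < C /\ eventually_nat (fun n => `|x n| <= C * a n).

Definition littleo_seq {R : realType} (x a : nat -> R) : Prop :=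
  forall e : R, 0 < e -> eventually_nat (fun n => `|x n| <= e * a n).

Definition bigOp {d} {T : measurableType d} {R : realType} (P : probability T R)
  (Z : nat -> T -> R) (a : nat -> R) : Prop :=
  forall e : R, 0 < e -> exists C : R, 0 < C /\
    eventually_nat (fun n => (P [set w | (C * a n < `|Z n w|)%R]%classic <= e%:E)%E).

Definition iid_seq {d} {T : measurableType d} {R : realType} (P : probability T R)
  (eps : nat -> {RV P >-> R}) : Prop :=
  (forall (S : seq nat) (A : nat -> set R), uniq S ->
     (forall i, measurable (A i)) ->
     P (\big[setI/setT]_(i <- S) (eps i @^-1` A i))%classic
     = (\prod_(i <- S) P (eps i @^-1` A i)%classic)%E) /\
  (forall (i : nat) (A : set R), measurable A ->
     P (eps i @^-1` A)%classic = P (eps 0%N @^-1` A)%classic).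

Section Model.
Variable R : realType.

Definition is_thin_svd (n p r : nat) (X : 'M[R]_(n, p)) (Pm : 'M[R]_(n, r))
  (lam : 'rV[R]_r) (Qm : 'M[R]_(p, r)) : Prop :=
  [/\ X = Pm *m diag_mx lam *m Qm^T,
      Pm^T *m Pm = 1%:M,
      Qm^T *m Qm = 1%:M,
      (forall k : 'I_r, 0 < lam 0 k) &
      (forall k l : 'I_r, (k <= l)%N -> lam 0 l <= lam 0 k)].

Definition theta (p r : nat) (Qm : 'M[R]_(p, r)) (beta : 'cV[R]_p) : 'cV[R]_p :=
  Qm *m Qm^T *m beta.

(* theta_perp = Q_perp Q_perp^T beta = (I - Q Q^T) beta *)
Definition theta_perp (p r : nat) (Qm : 'M[R]_(p, r)) (beta : 'cV[R]_p) : 'cV[R]_p :=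
  beta - theta Qm beta.

Definition Nset (p : nat) (b : R) (th : 'cV[R]_p) : {set 'I_p} :=
  [set i | b < `|th i 0|].

Definition cc (p1 p r : nat) (M : 'M[R]_(p1, p)) (Qm : 'M[R]_(p, r)) (N : {set 'I_p})
  (i : 'I_p1) (k : 'I_r) : R :=
  \sum_(j in N) M i j * Qm j k.

Definition Mset (p1 p r : nat) (M : 'M[R]_(p1, p)) (Qm : 'M[R]_(p, r)) (N : {set 'I_p})
  : {set 'I_p1} :=
  [set i | 0 < \sum_(k < r) cc M Qm N i k ^+ 2].

Definition yvec (n p : nat) (X : 'M[R]_(n, p)) (beta : 'cV[R]_p) (e : 'cV[R]_n)
  : 'cV[R]_n := X *m beta + e.

Definition theta_star (n p : nat) (X : 'M[R]_(n, p)) (rho : R) (y : 'cV[R]_n)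
  : 'cV[R]_p := invmx (X^T *m X + rho%:M) *m X^T *m y.

Definition theta_tilde (n p r : nat) (X : 'M[R]_(n, p)) (lam : 'rV[R]_r)
  (Qm : 'M[R]_(p, r)) (rho : R) (y : 'cV[R]_n) : 'cV[R]_p :=
  let ts := theta_star X rho y in
  ts + rho *: (Qm *m invmx (diag_mx lam *m diag_mx lam + rho%:M) *m Qm^T *m ts).

Definition theta_hat (p : nat) (b : R) (tt : 'cV[R]_p) : 'cV[R]_p :=
  \col_i (if i \in Nset b tt then tt i 0 else 0).

Definition sigma2_hat (n p : nat) (X : 'M[R]_(n, p)) (y : 'cV[R]_n) (th : 'cV[R]_p) : R :=
  (n%:R)^-1 * \sum_(i < n) (y i 0 - (X *m th) i 0) ^+ 2.

Definition maxabs (q : nat) (v : 'cV[R]_q) : R := \big[Num.max/0]_(i < q) `|v i 0|.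

End Model.

(* the error vector (eps_1, ..., eps_n)^T = (eps 0, ..., eps (n-1))^T at outcome w *)
Definition epsvec {d} {T : measurableType d} {R : realType} {P : probability T R}
  (eps : nat -> {RV P >-> R}) (n : nat) (w : T) : 'cV[R]_n :=
  \col_(i < n) eps i w.

(* Main.v *)
(** Writing theta, theta~ for the projected parameter and its debiased ridge estimator, the thin SVD gives
    theta~ - theta = Q (W P^T eps - D Q^T beta) with W = diag(w_k) of size O(n^-eta) and
    D = diag((rho/(lam_k^2 + rho))^2) of size O(n^(-2 delta)).  Hence every combination sum_k c_k (.)_k
    of the bracket is a weighted sum of the errors, with squared weights summing to
    O(n^(-2 eta)) |c|^2, minus a bias that is O(n^-eta |c|) because alpha_theta - 2 delta < -eta.
    A Marcinkiewicz-Zygmund inequality E|sum a_l eps_l|^q <= K (sum a_l^2)^(q/2) (real q >= 2) then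
    controls all moments.  With q = m, Markov's inequality and a union bound over the p coordinates give
    the selection claim, and a union bound over the set M of relevant rows gives the claim on gamma.
    For the variance, on the event of correct selection the residual is eps + g - h, where g = X theta
    off the selected set is deterministic and h = X (theta~ - theta) on the selected set; the square is
    expanded and q = 2 is applied to eps, to eps^2 - sigma^2 and to theta~ - theta. *)

Require Import Defs.
Set Warnings "-notation-overridden,-ambiguous-paths,-notation-incompatible-prefix".
From HB Require Import structures.
From mathcomp Require Import all_boot all_order all_algebra.
From mathcomp Require Import all_classical all_reals all_analysis.
From mathcomp Require Import measurable_realfun ring lra.
Import Order.TTheory GRing.Theory Num.Theory.
Local Open Scope ring_scope.

(** * Real powers *)

(** The exponent [m] is a real number above 4, so the moment of a weighted sum cannot be expanded as
    for an even integer. The moment inequality is proved by adding one variable at a time. A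
    pointwise bound on |x + y|^q keeps the linear term with its exact coefficient, because only an
    exact linear term is annihilated by centering; the rest is of order y^2 or |y|^q. The claim
    carried through the induction is E|S_k|^q <= (L (A + sum of the first k squared weights))^(q/2),
    with [L] so large that the growth of the right-hand side pays for the new terms. No
    symmetrization and no conditional expectation enter, but the joint law of a partial sum and the
    next variable must be shown to be a product, starting from independence on rectangles. Design,
    dimensions and weights change with n. The constant of the moment inequality is therefore fixed
    before them: it depends only on the exponent and on the law of one error, and the design enters
    through bounds on sums of squares alone. *)

Lemma expR_le_quadratic (R : realType) (u : R) : `|u| <= 1 / 2 ->
  expR u <= 1 + u + 2 * u ^+ 2.
Proof.
move=> hu; have [u1 u2] : - (1 / 2) <= u /\ u <= 1 / 2 by move: hu; rewrite ler_norml => /andP[].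
have h := expR_ge1Dx (- u); rewrite expRN in h.
have e0 := expR_gt0 u.
have : (1 - u) * expR u <= 1.
  have := ler_wpM2r (ltW e0) h; rewrite mulVf ?gt_eqF//.
set e := expR u in e0 *.
(* The product (1 - u)(1 + u + 2u^2) equals 1 + u^2 (1 - 2u), which is at least 1 for u <= 1/2. *)
move=> h1; have : (1 - u) * e <= (1 - u) * (1 + u + 2 * u ^+ 2) by nra.
by rewrite ler_pM2l//; lra.
Qed.

(** If m|t| <= 1/2, then 1 + t <= e^t and the quadratic bound on the exponential apply. Otherwise 1
    < 2m|t|, so the constant and the linear term are themselves dominated by |t| and t^2; hence the
    constants 2m + 1 and 2m^2. *)
Lemma powR_add1_le (R : realType) (m t : R) : 2 <= m ->
  `|1 + t| `^ m <= 1 + m * t + (2 * m ^+ 2 + (2 * m + 1) `^ m) * (t ^+ 2 + `|t| `^ m).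
Proof.
move=> m2; have m0 : 0 < m by lra.
set K := (2 * m + 1) `^ m; have K0 : 0 <= K by exact: powR_ge0.
have tm0 : 0 <= `|t| `^ m by exact: powR_ge0.
have t20 : 0 <= t ^+ 2 by exact: sqr_ge0.
have [ht|ht] := leP (`|m * t|) (1 / 2).
- have h1 := expR_le_quadratic _ _ ht.
  have t1 : 0 <= 1 + t.
    have : `|t| <= 1 / 2.
      apply: le_trans ht; rewrite normrM ler_peMl// ger0_norm; lra.
    by rewrite ler_norml => /andP[]; lra.
  have h2 : `|1 + t| `^ m <= expR (m * t).
    rewrite ger0_norm// mulrC expRM ge0_ler_powR ?nnegrE ?expR_ge0//; first lra.
    exact: expR_ge1Dx.
  apply: (le_trans h2); apply: (le_trans h1); rewrite -addrA -[leRHS]addrA; do 2 rewrite lerD2l.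
  rewrite exprMn; nra.
- have mt : m * `|t| <= 2 * m ^+ 2 * t ^+ 2.
    rewrite normrM gtr0_norm// in ht.
    rewrite -(real_normK (num_real t)) expr2; nra.
  have h1 : `|1 + t| <= (2 * m + 1) * `|t|.
    apply: (le_trans (ler_normD _ _)); rewrite normr1 normrM gtr0_norm// in ht *; lra.
  have h2 : `|1 + t| `^ m <= K * `|t| `^ m.
    rewrite /K -powRM//; last lra.
    by rewrite ge0_ler_powR ?nnegrE//; [lra|apply: mulr_ge0 => //; lra].
  have h3 : - (m * t) <= m * `|t| by rewrite -mulrN ler_pM2l// -normrN ler_norm.
  have h4 : 0 <= 2 * m ^+ 2 * `|t| `^ m by rewrite mulr_ge0// mulr_ge0// sqr_ge0.
  have h5 : 0 <= K * t ^+ 2 by rewrite mulr_ge0.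
  move: h2 h3 h4 h5 mt; set a := `|1 + t| `^ m; set b := `|t| `^ m; lra.
Qed.

(* The linear term integrates to [0] against a centered [y]; at [x = 0] its coefficient is the junk
   value [0]. *)
Lemma powR_add_le (R : realType) (m x y : R) : 2 <= m ->
  `|x + y| `^ m <= `|x| `^ m + m * `|x| `^ m / x * y +
    (2 * m ^+ 2 + (2 * m + 1) `^ m) * (`|x| `^ (m - 2) * y ^+ 2 + `|y| `^ m).
Proof.
move=> m2; have [->|x0] := eqVneq x 0.
  rewrite add0r invr0 mulr0 mul0r addr0 normr0 powR0; last by lra.
  rewrite add0r.
  set K := _ + _ `^ m.
  have K1 : 1 <= K.
    rewrite /K; have := powR_ge0 (2 * m + 1) m; nra.
  have h1 := powR_ge0 0 (m - 2); have h2 := sqr_ge0 y; have h3 := powR_ge0 `|y| m.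
  have h4 := mulr_ge0 h1 h2; nra.
have h := powR_add1_le _ m (y / x) m2.
have xm0 : 0 <= `|x| `^ m by exact: powR_ge0.
have := ler_wpM2l xm0 h.
rewrite -powRM//; rewrite -normrM.
have -> : x * (1 + y / x) = x + y by field.
move=> /le_trans; apply.
have e1 : `|x| `^ m = `|x| `^ (m - 2) * x ^+ 2.
  rewrite -(real_normK (num_real x)) -powR_mulrn// -powRD ?subrK//.
  by apply/implyP; rewrite normr_eq0 x0.
have e2 : `|x| `^ m * `|y / x| `^ m = `|y| `^ m.
  by rewrite -powRM// -normrM; congr (`| _ | `^ _); field.
rewrite le_eqVlt; apply/orP; left; apply/eqP.
set C := _ + _ `^ m.
rewrite !mulrDr mulr1 -!addrA; congr (_ + _).
congr (_ + _); first by field.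
rewrite [_ * (C * _)]mulrCA [_ * (C * _)]mulrCA e2 e1; congr (_ + _); by field.
Qed.

(** One factor s + u is split off; the remaining power dominates both s^(q-1) and u^(q-1), hence
    their average, which gives the 1/2. This is what the comparison scale gains when a squared
    weight u is added to it. *)
Lemma powR_add_ge (R : realType) (q s u : R) : 1 <= q -> 0 < s -> 0 <= u ->
  s `^ q + (u * s `^ (q - 1) + u `^ q) / 2 <= (s + u) `^ q.
Proof.
move=> q1 s0 u0; have su : 0 < s + u by lra.
rewrite -(mulr_powRB1 (ltW su))//; last lra.
rewrite -(mulr_powRB1 (ltW s0))//; last lra.
rewrite -(mulr_powRB1 u0)//; last lra.
have h1 : s `^ (q - 1) <= (s + u) `^ (q - 1).
  by rewrite ge0_ler_powR ?nnegrE//; lra.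
have h2 : u `^ (q - 1) <= (s + u) `^ (q - 1).
  by rewrite ge0_ler_powR ?nnegrE//; lra.
nra.
Qed.

(** A crude form of Young's inequality at a free scale [B]. With u = x^2 and q = m/2 it trades
    |x|^(m-2) for |x|^m, so that the induction on partial sums needs a single moment. *)
Lemma powR_sub1_le (R : realType) (q u B : R) : 1 <= q -> 0 <= u -> 0 < B ->
  u `^ (q - 1) <= B `^ (q - 1) + u `^ q / B.
Proof.
move=> q1 u0 B0; have h := powR_ge0 B (q - 1); have h2 := powR_ge0 u q.
have h3 : 0 <= u `^ q / B by rewrite divr_ge0// ltW.
have [uB|Bu] := leP u B.
  have : u `^ (q - 1) <= B `^ (q - 1) by rewrite ge0_ler_powR ?nnegrE//; lra.
  lra.
suff : u `^ (q - 1) <= u `^ q / B by lra.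
rewrite ler_pdivlMr// -(@mulr_powRB1 _ u q u0); last lra.
by have := powR_ge0 u (q - 1); nra.
Qed.

(** * Partial sums of independent variables *)

Lemma eq_finite_measure_prod (R : realType) d1 d2 (T1 : measurableType d1)
    (T2 : measurableType d2) (m1 m2 : {measure set (T1 * T2) -> \bar R}) :
  (m1 setT < +oo)%E ->
  (forall A B, measurable A -> measurable B -> m1 (A `*` B)%classic = m2 (A `*` B)%classic) ->
  forall C, measurable C -> m1 C = m2 C.
Proof.
move=> m1T m12 C mC.
pose G : set (set (T1 * T2)) := [set A `*` B | A in measurable & B in measurable]%classic.
apply: (measure_unique G (fun=> setT)) => //.
- by rewrite measurable_prod_measurableType.
- move=> _ _ [A1 mA1 [B1 mB1 <-]] [A2 mA2 [B2 mB2 <-]].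
  exists (A1 `&` A2)%classic; first exact: measurableI.
  by exists (B1 `&` B2)%classic; [exact: measurableI|rewrite setXI].
- by move=> _; exists setT => //; exists setT => //; rewrite setXTT.
- by apply/seteqP; split => // x _; exists 0%N.
- by move=> _ [A mA [B mB <-]]; exact: m12.
Qed.

(** The two halves of [iid_seq] are separated because the product law of partial sums rests on
    independence alone, and they are stated for arbitrary measurable functions so that they also
    cover transformed errors. *)
Definition indep_family {d} {T : measurableType d} {R : realType} (P : probability T R)
    (Z : nat -> {mfun T >-> R}) : Prop :=
  forall (S : seq nat) (A : nat -> set R), uniq S -> (forall i, measurable (A i)) ->
    P (\big[setI/setT]_(i <- S) (Z i @^-1` A i))%classic
    = (\prod_(i <- S) P (Z i @^-1` A i)%classic)%E.

Definition ident_family {d} {T : measurableType d} {R : realType} (P : probability T R)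
    (Z : nat -> {mfun T >-> R}) : Prop :=
  forall (i : nat) (A : set R), measurable A ->
    P (Z i @^-1` A)%classic = P (Z 0%N @^-1` A)%classic.

Section weighted_sum.
Local Open Scope classical_set_scope.
Local Open Scope ring_scope.
Context d (T : measurableType d) (R : realType) (P : probability T R).
Variables (Z : nat -> {mfun T >-> R}) (a : nat -> R).
Hypothesis indepZ : indep_family P Z.

Let S k (w : T) : R := \sum_(i < k) a i * Z i w.

Lemma measurable_weighted_sum k : measurable_fun setT (S k).
Proof.
apply: measurable_sum => i; apply: measurable_funM; first exact: measurable_cst.
exact: measurable_funPT.
Qed.

HB.instance Definition _ k := isMeasurableFun.Build _ _ _ _ (S k) (measurable_weighted_sum k).

Let rect (I : seq nat) (A : nat -> set R) := (\big[setI/setT]_(i <- I) (Z i @^-1` A i))%classic.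

Let measurable_rect I A : (forall i, measurable (A i)) -> measurable (rect I A).
Proof.
by move=> mA; apply: bigsetI_measurable => i _; exact: measurable_funPTI.
Qed.

Let SZ k w : R * R := (S k w, Z k w).

Let mSZ k : measurable_fun setT (SZ k).
Proof. by apply: measurable_fun_pair. Qed.

HB.instance Definition _ k := isMeasurableFun.Build _ _ _ _ (SZ k) (mSZ k).

(* Keeping a whole rectangle of later variables makes the induction on [k] go through: the laws of
   [(S k, Z k)] on the rectangle's event and on the whole space agree up to a factor on products. *)
Lemma indep_weighted_sum k (I : seq nat) (A : nat -> set R) (B : set R) :
  uniq I -> (forall i, i \in I -> (k <= i)%N) -> (forall i, measurable (A i)) -> measurable B ->
  P (S k @^-1` B `&` rect I A)%classic = (P (S k @^-1` B) * P (rect I A))%E.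
Proof.
elim: k I A B => [|k ih] I A B uI kI mA mB.
  have -> : S 0%N = cst 0 by apply/funext => w; rewrite /S big_ord0.
  rewrite preimage_cst; case: ifPn => _.
    by rewrite setTI probability_setT mul1e.
  by rewrite set0I measure0 mul0e.
pose E := rect I A; have mE : measurable E by exact: measurable_rect.
pose f := fun xy : R * R => xy.1 + a k * xy.2.
have mf : measurable_fun setT f.
  by apply: measurable_funD => //; apply: measurable_funM.
have SE : S k.+1 = f \o SZ k.
  by apply/funext => w; rewrite /f /S /= big_ord_recr.
have mC : measurable (f @^-1` B)%classic by rewrite -[X in measurable X]setTI; exact: mf.
pose c : {nonneg R} := NngNum (fine_ge0 (measure_ge0 P E)).
pose m1' : {measure set _ -> \bar R} := pushforward (mrestr P mE) (SZ k).
pose m1 := m1' (mSZ k).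
pose m2 : {measure set _ -> \bar R} := mscale c (distribution P (SZ k)).
rewrite SE !comp_preimage.
transitivity (m1 (f @^-1` B)%classic); first by [].
have PE : P E = (c%:num)%:E by rewrite /c /= fineK// fin_num_measure.
transitivity (m2 (f @^-1` B)%classic); last by rewrite /m2 /= /mscale /= PE muleC.
apply: eq_finite_measure_prod => //.
  rewrite /m1 /= /pushforward /mrestr /= preimage_setT setTI.
  by rewrite (le_lt_trans (probability_le1 _ _)) ?ltry.
move=> C D mC' mD.
have kI' : k \notin I by apply/negP => /kI; rewrite ltnn.
(* Putting the constraint [D] on index [k] yields a rectangle over indices that start at [k], so the
   induction hypothesis still applies to it. *)
pose A' := fun i => if i == k then D else A i.
have mA' i : measurable (A' i) by rewrite /A'; case: ifP.
have rectE : rect (k :: I) A' = (Z k @^-1` D `&` E)%classic.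
  rewrite /rect big_cons {1}/A' eqxx; congr setI.
  apply: eq_big_seq => i iI; rewrite /A'; case: eqP => // ik.
  by move: kI'; rewrite -ik iI.
have lt1 : P (SZ k @^-1` (C `*` D) `&` E)%classic = (P (S k @^-1` C) * P (Z k @^-1` D `&` E))%E.
  rewrite -rectE -ih//; first by rewrite rectE setIA; congr (P (_ `&` _)%classic).
    by rewrite /= kI'.
  by move=> i; rewrite inE => /orP[/eqP ->//|/kI /ltnW].
have lt2 : P (SZ k @^-1` (C `*` D))%classic = (P (S k @^-1` C) * P (Z k @^-1` D))%E.
  have := ih [:: k] A' C; rewrite /rect big_seq1 /A' eqxx; apply => //.
  by move=> i; rewrite inE => /eqP ->.
have lt3 : P (Z k @^-1` D `&` E)%classic = (P (Z k @^-1` D) * P E)%E.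
  rewrite -rectE (indepZ (k :: I)) //= ?kI'// big_cons {1}/A' eqxx.
  congr (_ * _)%E; rewrite indepZ//.
  apply: eq_big_seq => i iI; rewrite /A'; case: eqP => // ik.
  by move: kI'; rewrite -ik iI.
rewrite /m1 /m2 /= /mscale /= /pushforward /mrestr /= -PE lt1 /distribution /pushforward lt2 lt3.
by rewrite muleA muleC.
Qed.

Lemma weighted_sum_prod_measure k C : measurable C ->
  distribution P (SZ k) C = ((distribution P (S k)) \x (distribution P (Z k)))%E C.
Proof.
move=> mC; apply/esym; apply: product_measure_unique => // A B mA mB.
have := indep_weighted_sum k [:: k] (fun=> B) A erefl.
rewrite /rect big_seq1; apply => //.
by move=> i; rewrite inE => /eqP ->.
Qed.

(** Tonelli on the product law plays the role of conditioning on the past: the partial sum is frozen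
    at x, and the inner integral sees the law of [Z k] only, where centering can be used. *)
Lemma ge0_integral_weighted_sumS k (g : R -> \bar R) : measurable_fun setT g ->
  (forall x, (0 <= g x)%E) ->
  (\int[P]_w g (S k.+1 w) =
   \int[distribution P (S k)]_x \int[distribution P (Z k)]_y g (x + a k * y)%R)%E.
Proof.
move=> mg g0.
pose f := fun xy : R * R => xy.1 + a k * xy.2.
have mf : measurable_fun setT f.
  by apply: measurable_funD => //; apply: measurable_funM.
have mgf : measurable_fun setT (g \o f) by apply: measurableT_comp.
transitivity (\int[distribution P (SZ k)]_z (g \o f) z)%E.
  rewrite ge0_integral_distribution//; last by move=> y; exact: g0.
  by apply: eq_integral => w _; rewrite /f /S /= big_ord_recr.
transitivity (\int[(distribution P (S k) \x distribution P (Z k))%E]_z (g \o f) z)%E.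
  by apply: eq_measure_integral => C mC _; exact: weighted_sum_prod_measure.
by rewrite fubini_tonelli1// => z; exact: g0.
Qed.

End weighted_sum.

(** * A Marcinkiewicz-Zygmund inequality *)

(** This closes the induction. The parenthesis and the second summand each contribute the correction
    c2 u (L s)^(q-1); together they fit into half of L^q u s^(q-1) because 4 c2 <= L. The last
    summand fits into half of L^q u^q because 2 cm <= L <= L^q. Both halves are supplied by
    [powR_add_ge]. *)
Lemma moment_step_le (R : realType) (q s u L c2 cm : R) :
  1 <= q -> 0 < s -> 0 <= u -> 1 <= L -> 0 <= c2 -> 4 * c2 <= L -> 2 * cm <= L ->
  (L * s) `^ q * (1 + c2 * u / (L * s)) + c2 * u * (L * s) `^ (q - 1) + cm * u `^ q
    <= (L * (s + u)) `^ q.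
Proof.
move=> q1 s0 u0 L1 c20 hc2 hcm.
have L0 : 0 < L by lra.
have Ls0 : 0 < L * s by rewrite mulr_gt0.
have e : (L * s) `^ q = (L * s) * (L * s) `^ (q - 1) by rewrite mulr_powRB1//; lra.
have -> : (L * s) `^ q * (1 + c2 * u / (L * s)) = (L * s) `^ q + c2 * u * (L * s) `^ (q - 1).
  by rewrite e; field; rewrite !gt_eqF.
rewrite !powRM//; try lra.
apply: (@le_trans _ _ (L `^ q * (s `^ q + (u * s `^ (q - 1) + u `^ q) / 2))); last first.
  by rewrite ler_wpM2l ?powR_ge0// powR_add_ge.
have eL : L `^ q = L * L `^ (q - 1) by rewrite mulr_powRB1//; lra.
have L1q : L <= L `^ q by rewrite le1r_powR.
have a0 : 0 <= L `^ (q - 1) by exact: powR_ge0.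
have b0 : 0 <= s `^ (q - 1) by exact: powR_ge0.
have d0 : 0 <= u `^ q by exact: powR_ge0.
have h1 : cm * u `^ q <= L `^ q * (u `^ q) / 2.
  by rewrite mulrAC ler_wpM2r// ; lra.
have h2 : 2 * (c2 * u * (L `^ (q - 1) * s `^ (q - 1))) <= L `^ q * (u * s `^ (q - 1)) / 2.
  rewrite eL; have h : 0 <= u * (L `^ (q - 1) * s `^ (q - 1)) by rewrite !mulr_ge0.
  have := ler_wpM2r h hc2; nra.
lra.
Qed.

Lemma sqr_le_1Dpowr (R : realType) (m y : R) : 2 <= m -> y ^+ 2 <= 1 + `|y| `^ m.
Proof.
move=> m2; have := powR_ge0 `|y| m; rewrite -(real_normK (num_real y)) => h.
have [y1|y1] := leP `|y| 1; first by have := normr_ge0 y; nra.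
suff : `|y| ^+ 2 <= `|y| `^ m by lra.
by rewrite -powR_mulrn// ler_powR// ltW.
Qed.

Lemma norm_le_1Dpowr (R : realType) (m y : R) : 1 <= m -> `|y| <= 1 + `|y| `^ m.
Proof.
move=> m1; have := powR_ge0 `|y| m => h.
have [y1|y1] := leP `|y| 1; first by lra.
by have : `|y| <= `|y| `^ m; [rewrite le1r_powR// ltW|lra].
Qed.

Lemma measurable_normr_powR (R : realType) (m : R) : measurable_fun setT (fun y : R => `|y| `^ m).
Proof.
by apply: (@measurableT_comp _ _ _ _ _ _ (fun x : R => x `^ m)) => //; exact: measurable_powR.
Qed.

Lemma integrable_normr_powR (R : realType) (mu : probability R R) (m : R) :
  (\int[mu]_y (`|y| `^ m)%:E < +oo)%E ->
  mu.-integrable setT (fun y => (`|y| `^ m)%:E).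
Proof.
move=> mum; apply/integrableP; split; first by apply/measurable_EFinP; exact: measurable_normr_powR.
under eq_integral do rewrite gee0_abs ?lee_fin ?powR_ge0//.
exact: mum.
Qed.

Lemma integrable_dom_normr_powR (R : realType) (mu : probability R R) (m : R) (g : R -> R) :
  (\int[mu]_y (`|y| `^ m)%:E < +oo)%E ->
  measurable_fun setT g ->
  (forall y, `|g y| <= 1 + `|y| `^ m) -> mu.-integrable setT (EFin \o g).
Proof.
move=> mum mg hg.
have h : mu.-integrable setT (fun y => 1%:E + (`|y| `^ m)%:E)%E.
  apply: integrableD => //; [exact: finite_measure_integrable_cst|exact: integrable_normr_powR].
apply: le_integrable h => //; first exact/measurable_EFinP.
move=> y _ /=; rewrite lee_fin; apply: (le_trans (hg y)); exact: ler_norm.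
Qed.

(** Integrating the pointwise bound in y removes the linear term and leaves |x|^(m-2) times the
    variance. That lower power is exchanged for |x|^m at the scale [B], which stays free here and
    becomes the bound already known for the partial sum. *)
Lemma moment_inner_le (R : realType) (mu : probability R R) (m : R) (C x a B : R) :
  2 <= m -> (\int[mu]_y y%:E = 0)%E ->
  (\int[mu]_y (`|y| `^ m)%:E < +oo)%E ->
  C = 2 * m ^+ 2 + (2 * m + 1) `^ m -> 0 < B ->
  (\int[mu]_y (`|x + a * y| `^ m)%:E <=
   (`|x| `^ m * (1 + C * fine (\int[mu]_y (y ^+ 2)%:E) * a ^+ 2 / B) +
    (C * fine (\int[mu]_y (y ^+ 2)%:E) * a ^+ 2 * B `^ (m / 2 - 1) +
     C * fine (\int[mu]_y (`|y| `^ m)%:E) * (a ^+ 2) `^ (m / 2)))%:E)%E.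
Proof.
move=> m2 mu0 mum CE B0; have m1 : 1 <= m by lra.
have i1 : mu.-integrable setT (EFin \o (@id R)).
  apply: (integrable_dom_normr_powR _ _ m _ mum) => // y; exact: norm_le_1Dpowr.
have i2 : mu.-integrable setT (EFin \o (fun y : R => y ^+ 2)).
  apply: (integrable_dom_normr_powR _ _ m _ mum) => [|y]; first exact: measurable_funX.
  by rewrite ger0_norm ?sqr_ge0//; exact: sqr_le_1Dpowr.
have i3 := integrable_normr_powR _ _ _ mum.
set M2 := fine _; set Mm := fine _.
have M2E : (\int[mu]_y (y ^+ 2)%:E = M2%:E)%E by rewrite /M2 fineK// integrable_fin_num.
have MmE : (\int[mu]_y (`|y| `^ m)%:E = Mm%:E)%E by rewrite /Mm fineK// integrable_fin_num.
have M20 : 0 <= M2 by rewrite fine_ge0// integral_ge0// => y _; rewrite lee_fin sqr_ge0.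
have C0 : 0 <= C by rewrite CE addr_ge0 ?powR_ge0// mulr_ge0// sqr_ge0.
have am : `|a| `^ m = (a ^+ 2) `^ (m / 2).
  by rewrite -(real_normK (num_real a)) -powR_mulrn// -powRrM; congr (_ `^ _); field.
have xm : `|x| `^ m = (x ^+ 2) `^ (m / 2).
  by rewrite -(real_normK (num_real x)) -powR_mulrn// -powRrM; congr (_ `^ _); field.
have xm2 : `|x| `^ (m - 2) = (x ^+ 2) `^ (m / 2 - 1).
  by rewrite -(real_normK (num_real x)) -powR_mulrn// -powRrM; congr (_ `^ _); field.
pose al := `|x| `^ m; pose be := m * `|x| `^ m / x * a.
pose ga := C * `|x| `^ (m - 2) * a ^+ 2; pose ka := C * `|a| `^ m.
have ii : mu.-integrable setT
  (fun y => al%:E + (be%:E * y%:E + (ga%:E * (y ^+ 2)%:E + ka%:E * (`|y| `^ m)%:E)))%E.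
  apply: integrableD => //; first exact: finite_measure_integrable_cst.
  apply: integrableD => //; first exact: integrableZl.
  by apply: integrableD => //; exact: integrableZl.
apply: (@le_trans _ _ (\int[mu]_y
  (al%:E + (be%:E * y%:E + (ga%:E * (y ^+ 2)%:E + ka%:E * (`|y| `^ m)%:E))))%E).
  apply: ge0_le_integral => //.
  - apply/measurable_EFinP.
    apply: (@measurableT_comp _ _ _ _ _ _ (fun x : R => x `^ m)) => //.
    apply: measurableT_comp => //; apply: measurable_funD => //.
  - by apply: (measurable_int mu).
  - move=> y _; rewrite -!EFinM -!EFinD lee_fin.
    have := powR_add_le _ m x (a * y) m2; rewrite -CE /al /be /ga /ka normrM powRM//.
    move=> /le_trans; apply; rewrite le_eqVlt; apply/orP; left; apply/eqP.
    ring.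
rewrite integralD//; last 2 first.
  - exact: finite_measure_integrable_cst.
  - apply: integrableD => //; first exact: integrableZl.
    by apply: integrableD => //; exact: integrableZl.
rewrite integralD//; last 2 first.
  - exact: integrableZl.
  - by apply: integrableD => //; exact: integrableZl.
rewrite integralD//; last 2 first.
  - exact: integrableZl.
  - exact: integrableZl.
rewrite integral_cst// [X in (_ * X)%E]probability_setT mule1.
rewrite integralZl// integralZl// integralZl// mu0 mule0 add0e M2E MmE -!EFinM -!EFinD lee_fin.
rewrite /al /ga /ka am.
have q1 : 1 <= m / 2 by lra.
have := powR_sub1_le _ (m / 2) (x ^+ 2) B q1 (sqr_ge0 x) B0.
rewrite -xm -xm2 => h.
have h2 : 0 <= C * M2 * a ^+ 2. by apply: mulr_ge0; [exact: mulr_ge0|exact: sqr_ge0].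
have := ler_wpM2l h2 h.
set t := _ `^ (m / 2 - 1); set v := (a ^+ 2) `^ _; set z := `|x| `^ m; set w := `|x| `^ (m - 2).
move=> h3; rewrite -subr_ge0; move: h3; rewrite -subr_ge0; move/le_trans; apply.
by rewrite le_eqVlt; apply/orP; left; apply/eqP; field; rewrite gt_eqF.
Qed.

(** Quantifying over an upper bound [A] > 0 of the sum of squares, and not using the sum itself,
    covers vanishing weights and lets callers insert their rate directly. *)
Lemma moment_weighted_sum d (T : measurableType d) (R : realType) (P : probability T R)
    (Z : nat -> {mfun T >-> R}) (m : R) :
  2 <= m -> indep_family P Z -> ident_family P Z ->
  (\int[P]_w (Z 0%N w)%:E = 0)%E ->
  (\int[P]_w (`|Z 0%N w| `^ m)%:E < +oo)%E ->
  exists K : R, 0 < K /\ forall (a : nat -> R) (k : nat) (A : R), 0 < A ->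
    \sum_(i < k) a i ^+ 2 <= A ->
    (\int[P]_w (`|\sum_(i < k) a i * Z i w| `^ m)%:E <= (K * A `^ (m / 2))%:E)%E.
Proof.
move=> m2 indZ idZ EZ EZm.
pose mu : probability R R := distribution P (Z 0%N).
have mum : (\int[mu]_y (`|y| `^ m)%:E < +oo)%E.
  rewrite ge0_integral_distribution//.
  by apply/measurable_EFinP; exact: measurable_normr_powR.
have intZ : P.-integrable setT (EFin \o Z 0%N).
  apply/integrableP; split; first exact/measurable_EFinP.
  have : (\int[mu]_y `|y%:E| < +oo)%E.
    have : mu.-integrable setT (EFin \o @id R).
      apply: (integrable_dom_normr_powR _ _ m _ mum) => // y.
      by apply: norm_le_1Dpowr; lra.
    by move=> /integrableP[].
  by rewrite ge0_integral_distribution//; apply: measurableT_comp.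
have mu0 : (\int[mu]_y y%:E = 0)%E by rewrite integral_distribution.
pose C := 2 * m ^+ 2 + (2 * m + 1) `^ m.
have C0 : 0 <= C by rewrite addr_ge0 ?powR_ge0// mulr_ge0// sqr_ge0.
pose M2 := fine (\int[mu]_y (y ^+ 2)%:E)%E; pose Mm := fine (\int[mu]_y (`|y| `^ m)%:E)%E.
have M20 : 0 <= M2 by rewrite fine_ge0// integral_ge0// => y _; rewrite lee_fin sqr_ge0.
have Mm0 : 0 <= Mm by rewrite fine_ge0// integral_ge0// => y _; rewrite lee_fin powR_ge0.
(* The factors 4 and 2 are those that [moment_step_le] asks for, and the 1 ensures L <= L^(m/2). *)
pose L := 1 + 4 * (C * M2) + 2 * (C * Mm).
have [cm2 cmm] : 0 <= C * M2 /\ 0 <= C * Mm by split; exact: mulr_ge0.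
have L1 : 1 <= L by rewrite /L; lra.
exists ((2 * L) `^ (m / 2)); split; first by apply: powR_gt0; lra.
move=> a k A A0 ha.
have q1 : 1 <= m / 2 by lra.
have msum j : measurable_fun setT (fun w => \sum_(i < j) a i * Z i w).
  exact: measurable_weighted_sum.
(* The shift by [A] keeps the comparison scale positive while the partial sums of squares may vanish. *)
suff h : (\int[P]_w (`|\sum_(i < k) a i * Z i w| `^ m)%:E <=
    ((L * (A + \sum_(i < k) a i ^+ 2)) `^ (m / 2))%:E)%E.
  apply: (le_trans h); rewrite lee_fin -powRM; [|lra|lra].
  have s0 : 0 <= \sum_(i < k) a i ^+ 2 by apply: sumr_ge0 => i _; exact: sqr_ge0.
  rewrite ge0_ler_powR ?nnegrE//; [lra|rewrite mulr_ge0//; lra|rewrite mulr_ge0//; lra|].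
  have L0 : 0 <= L by lra.
  have h2 : A + \sum_(i < k) a i ^+ 2 <= 2 * A by lra.
  by have := ler_wpM2l L0 h2; lra.
clear ha; elim: k => [|k ih].
  under eq_integral do (rewrite big_ord0 normr0 powR0; last by rewrite gt_eqF//; lra).
  by rewrite integral0 lee_fin powR_ge0.
pose g : R -> \bar R := fun x => (`|x| `^ m)%:E.
have mg : measurable_fun setT g by apply/measurable_EFinP; exact: measurable_normr_powR.
have g0 x : (0 <= g x)%E by rewrite lee_fin powR_ge0.
pose Sk w := \sum_(i < k) a i * Z i w.
(* At this scale the induction hypothesis reads E|S_k|^m <= B^(m/2), so that E|S_k|^m / B and
   B^(m/2-1), the two parts of the traded lower power, have the same size. *)
pose B := L * (A + \sum_(i < k) a i ^+ 2).
have s0 : 0 < A + \sum_(i < k) a i ^+ 2.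
  by rewrite ltr_wpDr// sumr_ge0// => i _; exact: sqr_ge0.
have B0 : 0 < B by rewrite mulr_gt0//; lra.
rewrite (ge0_integral_weighted_sumS _ _ _ P Z a indZ k g mg g0).
pose c1 := 1 + C * M2 * a k ^+ 2 / B.
pose c0 := C * M2 * a k ^+ 2 * B `^ (m / 2 - 1) + C * Mm * (a k ^+ 2) `^ (m / 2).
have c10 : 0 <= c1 by rewrite /c1 addr_ge0// mulr_ge0 ?invr_ge0 ?(ltW B0)// mulr_ge0// sqr_ge0.
have c00 : 0 <= c0 by rewrite addr_ge0// mulr_ge0 ?powR_ge0// mulr_ge0// sqr_ge0.
set nu := distribution P _.
apply: (@le_trans _ _ (\int[nu]_x (c1%:E * g x + c0%:E))%E).
  apply: ge0_le_integral => //.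
  - by move=> x _; apply: integral_ge0 => y _; exact: g0.
  - have mgf : measurable_fun setT (fun xy : R * R => g (xy.1 + a k * xy.2)).
      apply: (measurableT_comp mg); apply: measurable_funD => //.
      by apply: measurable_funM.
    apply: (@measurable_fun_fubini_tonelli_F _ _ _ _ _ (distribution P (Z k))
      (fun xy : R * R => g (xy.1 + a k * xy.2))) => //.
  - by apply: emeasurable_funD => //; exact: emeasurable_funM.
  - move=> x _.
    rewrite (_ : (\int[_]_y _)%E = (\int[mu]_y (`|x + a k * y| `^ m)%:E)%E); last first.
      by apply: eq_measure_integral => D mD _; exact: idZ.
    rewrite -EFinM -EFinD.
    have := moment_inner_le _ mu m C x (a k) B m2 mu0 mum erefl B0.
    by rewrite -/M2 -/Mm [`|x| `^ m * _]mulrC.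
rewrite ge0_integralD//; last 2 first.
  - by move=> x _; rewrite mule_ge0.
  - by apply: emeasurable_funM.
rewrite ge0_integralZl//.
rewrite integral_cst// [X in (_ + _ * X)%E]probability_setT mule1.
rewrite ge0_integral_distribution//.
apply: (@le_trans _ _ (c1%:E * (B `^ (m / 2))%:E + c0%:E)%E).
  by rewrite leeD2r// lee_wpmul2l.
rewrite -EFinM -EFinD lee_fin big_ord_recr /= addrA.
have hM2 : 4 * (C * M2) <= L by rewrite /L; lra.
have hMm : 2 * (C * Mm) <= L by rewrite /L; lra.
have := moment_step_le _ _ _ _ _ _ _ q1 s0 (sqr_ge0 (a k)) L1 cm2 hM2 hMm.
by rewrite -/B -/c1 mulrC /c0 addrA.
Qed.

(** * Ridge regression in the singular basis *)

(** Lagrange's identity: the double sum of the squares (a_i b_j - a_j b_i)^2 is twice the difference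
    of the two sides. *)
Lemma sum_sqr_Cauchy (R : realDomainType) (I : finType) (a b : I -> R) :
  (\sum_i a i * b i) ^+ 2 <= (\sum_i a i ^+ 2) * (\sum_i b i ^+ 2).
Proof.
have : 0 <= \sum_i \sum_j (a i * b j - a j * b i) ^+ 2.
  by apply: sumr_ge0 => i _; apply: sumr_ge0 => j _; exact: sqr_ge0.
have -> : \sum_i \sum_j (a i * b j - a j * b i) ^+ 2 =
    \sum_i \sum_j (a i ^+ 2 * b j ^+ 2) + \sum_i \sum_j (a j ^+ 2 * b i ^+ 2)
    - 2 * \sum_i \sum_j (a i * b i) * (a j * b j).
  rewrite -big_split /= mulr_sumr -sumrB; apply: eq_bigr => i _.
  rewrite -big_split /= mulr_sumr -sumrB; apply: eq_bigr => j _; ring.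
have -> : \sum_i \sum_j (a j ^+ 2 * b i ^+ 2) = \sum_i \sum_j (a i ^+ 2 * b j ^+ 2).
  by rewrite exchange_big.
have <- : (\sum_i a i ^+ 2) * (\sum_i b i ^+ 2) = \sum_i \sum_j (a i ^+ 2 * b j ^+ 2).
  by rewrite mulr_suml; apply: eq_bigr => i _; rewrite mulr_sumr.
have <- : (\sum_i a i * b i) ^+ 2 = \sum_i \sum_j (a i * b i) * (a j * b j).
  by rewrite expr2 mulr_suml; apply: eq_bigr => i _; rewrite mulr_sumr.
by lra.
Qed.

Lemma sum_sqr_cV (R : comNzRingType) (n : nat) (v : 'cV[R]_n) :
  \sum_(i < n) v i 0 ^+ 2 = (v^T *m v) 0 0.
Proof. by rewrite mxE; apply: eq_bigr => i _; rewrite mxE expr2. Qed.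

Lemma sum_sqr_orthonormal (R : comNzRingType) (n r : nat) (Qm : 'M[R]_(n, r)) (v : 'cV[R]_r) :
  Qm^T *m Qm = 1%:M -> \sum_(i < n) (Qm *m v) i 0 ^+ 2 = \sum_(k < r) v k 0 ^+ 2.
Proof.
by move=> QQ; rewrite !sum_sqr_cV trmx_mul mulmxA -(mulmxA v^T) QQ mulmx1.
Qed.

(** Bessel's inequality, by Pythagoras: z = Q Q^T v is orthogonal to v - z, and z has the same norm
    as Q^T v. *)
Lemma sum_sqr_proj_le (R : realDomainType) (p r : nat) (Qm : 'M[R]_(p, r)) (v : 'cV[R]_p) :
  Qm^T *m Qm = 1%:M -> \sum_(k < r) (Qm^T *m v) k 0 ^+ 2 <= \sum_(i < p) v i 0 ^+ 2.
Proof.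
move=> QQ; rewrite -(sum_sqr_orthonormal _ _ _ _ (Qm^T *m v) QQ).
set z := Qm *m _.
have -> : \sum_(i < p) v i 0 ^+ 2 =
    \sum_(i < p) z i 0 ^+ 2 + \sum_(i < p) (v - z) i 0 ^+ 2; last first.
  by rewrite lerDl sumr_ge0// => i _; exact: sqr_ge0.
have zz : z^T *m z = z^T *m v.
  rewrite /z !trmx_mul trmxK -!mulmxA; congr (_ *m (_ *m _)).
  by rewrite mulmxA QQ mul1mx.
have h : \sum_(i < p) z i 0 ^+ 2 = \sum_(i < p) z i 0 * v i 0.
  by rewrite sum_sqr_cV zz mxE; apply: eq_bigr => i _; rewrite mxE.
have -> : \sum_(i < p) (v - z) i 0 ^+ 2 =
    \sum_(i < p) v i 0 ^+ 2 - 2 * \sum_(i < p) z i 0 * v i 0 + \sum_(i < p) z i 0 ^+ 2.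
  rewrite mulr_sumr -sumrB -big_split /=; apply: eq_bigr => i _.
  by rewrite !mxE; ring.
by rewrite -h; ring.
Qed.

(** Bessel's inequality for a basis vector. Thanks to it each coordinate of the estimation error is
    a combination with |c| <= 1, which makes the moment bounds uniform over the coordinates. *)
Lemma sum_sqr_row_orthonormal_le1 (R : realFieldType) (p r : nat) (Qm : 'M[R]_(p, r)) (i : 'I_p) :
  Qm^T *m Qm = 1%:M -> \sum_(k < r) Qm i k ^+ 2 <= 1.
Proof.
move=> QQ; have := sum_sqr_proj_le _ _ _ Qm (delta_mx i 0) QQ.
have -> : \sum_(j < p) (delta_mx i 0 : 'cV[R]_p) j 0 ^+ 2 = 1.
  rewrite (bigD1 i) //= mxE !eqxx expr1n big1 ?addr0// => j ji.
  by rewrite mxE (negPf ji) expr0n.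
apply: le_trans; rewrite le_eqVlt; apply/orP; left; apply/eqP/eq_bigr => k _.
by rewrite -colE !mxE.
Qed.

Definition ridge_weight {R : realType} {r : nat} (lam : 'rV[R]_r) (rho : R) : 'rV[R]_r :=
  \row_k (lam 0 k / (lam 0 k ^+ 2 + rho) + rho * lam 0 k / (lam 0 k ^+ 2 + rho) ^+ 2).

(** With t = rho / (lam_k^2 + rho), plain ridge keeps the fraction 1 - t of the k-th coordinate and
    the correction multiplies it by 1 + t. The lost fraction is therefore t^2: debiasing squares the
    shrinkage. *)
Definition ridge_bias {R : realType} {r : nat} (lam : 'rV[R]_r) (rho : R) : 'rV[R]_r :=
  \row_k (rho / (lam 0 k ^+ 2 + rho)) ^+ 2.

Definition ridge_error {R : realType} {n p r : nat} (Pm : 'M[R]_(n, r)) (lam : 'rV[R]_r) (Qm : 'M[R]_(p, r))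
    (rho : R) (beta : 'cV[R]_p) (e : 'cV[R]_n) : 'cV[R]_r :=
  diag_mx (ridge_weight lam rho) *m (Pm^T *m e)
  - diag_mx (ridge_bias lam rho) *m (Qm^T *m beta).

Lemma theta_tildeE (R : realType) (n p r : nat) (X : 'M[R]_(n, p)) (Pm : 'M[R]_(n, r))
    (lam : 'rV[R]_r) (Qm : 'M[R]_(p, r)) (rho : R) (beta : 'cV[R]_p) (e : 'cV[R]_n) :
  is_thin_svd X Pm lam Qm -> 0 < rho ->
  theta_tilde X lam Qm rho (yvec X beta e)
  = theta Qm beta + Qm *m ridge_error Pm lam Qm rho beta e.
Proof.
move=> [XE PP QQ lam0 _] rho0.
pose s : 'rV[R]_r := \row_k (lam 0 k ^+ 2 + rho).
pose si : 'rV[R]_r := \row_k (lam 0 k ^+ 2 + rho)^-1.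
have s0 k : 0 < lam 0 k ^+ 2 + rho by rewrite ltr_wpDl// sqr_ge0.
have sE : diag_mx lam *m diag_mx lam + rho%:M = diag_mx s.
  rewrite mulmx_diag -diag_const_mx -linearD; congr diag_mx.
  by apply/rowP => k; rewrite !mxE expr2.
have ssi : diag_mx s *m diag_mx si = 1%:M.
  rewrite mulmx_diag -diag_const_mx; congr diag_mx.
  by apply/rowP => k; rewrite !mxE mulfV// gt_eqF.
have sU : diag_mx s \in unitmx by exact: (mulmx1_unit ssi).1.
have siE : invmx (diag_mx s) = diag_mx si.
  by rewrite -[LHS]mulmx1 -ssi mulKmx.
have XTE : X^T = Qm *m diag_mx lam *m Pm^T.
  by rewrite XE !trmx_mul trmxK tr_diag_mx mulmxA.
pose A := X^T *m X + rho%:M.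
have XXE : X^T *m X = Qm *m (diag_mx lam *m diag_mx lam) *m Qm^T.
  by rewrite XTE XE -!mulmxA; do 2 congr (_ *m _); rewrite !mulmxA PP mul1mx.
(* The columns of [Qm] are eigenvectors of the regularized Gram matrix; all later cancellations rest
   on this identity. *)
have AQ : A *m Qm = Qm *m diag_mx s.
  rewrite /A mulmxDl XXE -!mulmxA QQ mulmx1 -sE mulmxDr; congr (_ + _).
  by rewrite mul_scalar_mx mul_mx_scalar.
have AU : A \in unitmx.
  (* explicit inverse of [A], diagonal on the range of [Qm] and on its complement *)
  pose G := Qm *m diag_mx si *m Qm^T + rho^-1 *: (1%:M - Qm *m Qm^T).
  suff : A *m G = 1%:M by move=> /mulmx1_unit[].
  rewrite /G mulmxDr !mulmxA AQ -(mulmxA Qm) ssi mulmx1 -scalemxAr mulmxBr mulmx1 mulmxA AQ.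
  have -> : A - Qm *m diag_mx s *m Qm^T = rho *: (1%:M - Qm *m Qm^T).
    rewrite /A XXE -sE mulmxDr mul_mx_scalar mulmxDl opprD addrACA subrr add0r.
    by rewrite -scalemxAl scalerBr scalemx1.
  by rewrite scalerA mulVf ?gt_eqF// scale1r addrC subrK.
have starE y : theta_star X rho y = Qm *m (diag_mx si *m (diag_mx lam *m (Pm^T *m y))).
  rewrite /theta_star -/A.
  (* Once the transposed design is factored through [A], the inverse cancels, and its action on the
     complement of the range of [Qm] never enters. *)
  have -> : X^T = A *m (Qm *m (diag_mx si *m (diag_mx lam *m Pm^T))).
    by rewrite mulmxA AQ -!mulmxA (mulmxA (diag_mx s)) ssi mul1mx XTE mulmxA.
  rewrite -mulmxA -(mulmxA A) mulKmx// -!mulmxA.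
  by [].
rewrite /theta_tilde starE sE siE.
have -> : forall z : 'cV[R]_r, Qm *m z +
    rho *: (Qm *m diag_mx si *m Qm^T *m (Qm *m z)) = Qm *m (z + rho *: (diag_mx si *m z)).
  move=> z; rewrite mulmxDr -scalemxAr -!mulmxA; congr (_ + _ *: (_ *m (_ *m _))).
  by rewrite mulmxA QQ mul1mx.
rewrite /theta -mulmxA -mulmxDr; congr (_ *m _).
have -> : Pm^T *m yvec X beta e = diag_mx lam *m (Qm^T *m beta) + Pm^T *m e.
  by rewrite /yvec mulmxDr XE -!mulmxA (mulmxA Pm^T) PP mul1mx.
rewrite /ridge_error; apply/colP => k.
move: (Qm^T *m beta) (Pm^T *m e) => u v.
rewrite !mul_diag_mx !mxE.
by field; rewrite gt_eqF.
Qed.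

Lemma ridge_error_dot (R : realType) (n p r : nat) (Pm : 'M[R]_(n, r))
    (lam : 'rV[R]_r) (Qm : 'M[R]_(p, r)) (rho : R) (beta : 'cV[R]_p) (e : 'cV[R]_n)
    (c : 'I_r -> R) :
  \sum_(k < r) c k * ridge_error Pm lam Qm rho beta e k 0 =
  \sum_(l < n) (\sum_(k < r) c k * ridge_weight lam rho 0 k * Pm l k) * e l 0
  - \sum_(k < r) c k * ridge_bias lam rho 0 k * (Qm^T *m beta) k 0.
Proof.
have -> : \sum_(l < n) (\sum_(k < r) c k * ridge_weight lam rho 0 k * Pm l k) * e l 0 =
    \sum_(k < r) c k * ridge_weight lam rho 0 k * (Pm^T *m e) k 0.
  under eq_bigr do rewrite mulr_suml.
  rewrite exchange_big /=; apply: eq_bigr => k _.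
  rewrite [(Pm^T *m e) k 0]mxE mulr_sumr; apply: eq_bigr => l _.
  by rewrite [Pm^T k l]mxE !mulrA.
rewrite -sumrB; apply: eq_bigr => k _.
rewrite /ridge_error; move: (Qm^T *m beta) (Pm^T *m e) => u v.
move: (ridge_weight lam rho) (ridge_bias lam rho) => w D.
by rewrite !mul_diag_mx !mxE; ring.
Qed.

(** The weights of the errors are the entries of [Pm] applied to the vector (c_k w_k), and [Pm] is
    an isometry. *)
Lemma ridge_noise_sqr_le (R : realType) (n r : nat) (Pm : 'M[R]_(n, r)) (w : 'rV[R]_r)
    (c : 'I_r -> R) (W : R) :
  Pm^T *m Pm = 1%:M -> (forall k, `|w 0 k| <= W) ->
  \sum_(l < n) (\sum_(k < r) c k * w 0 k * Pm l k) ^+ 2 <= W ^+ 2 * \sum_(k < r) c k ^+ 2.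
Proof.
move=> PP hw.
have := sum_sqr_orthonormal R n r Pm (\col_k (c k * w 0 k)) PP.
under eq_bigr do rewrite mxE.
under [in X in X = _ -> _]eq_bigr do under eq_bigr do rewrite mxE mulrC.
move=> ->; rewrite mulr_sumr; apply: ler_sum => k _.
rewrite mxE exprMn mulrC ler_wpM2r ?sqr_ge0//.
by rewrite -(real_normK (num_real (w 0 k))) lerXn2r ?nnegrE// (le_trans _ (hw k)).
Qed.

(** Cauchy-Schwarz, where Q^T beta is measured by the norm of theta = Q (Q^T beta), the quantity
    that the assumptions control. *)
Lemma ridge_bias_sqr_le (R : realType) (p r : nat) (Qm : 'M[R]_(p, r)) (beta : 'cV[R]_p)
    (D : 'rV[R]_r) (c : 'I_r -> R) (B : R) :
  Qm^T *m Qm = 1%:M -> (forall k, `|D 0 k| <= B) ->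
  (\sum_(k < r) c k * D 0 k * (Qm^T *m beta) k 0) ^+ 2 <=
  B ^+ 2 * (\sum_(k < r) c k ^+ 2) * \sum_(j < p) theta Qm beta j 0 ^+ 2.
Proof.
move=> QQ hD.
rewrite /theta -mulmxA (sum_sqr_orthonormal R p r Qm _ QQ).
apply: (le_trans (sum_sqr_Cauchy _ _ _ _)).
rewrite ler_wpM2r//; first by apply: sumr_ge0 => k _; exact: sqr_ge0.
rewrite mulr_sumr; apply: ler_sum => k _.
rewrite exprMn mulrC ler_wpM2r ?sqr_ge0//.
by rewrite -(real_normK (num_real (D 0 k))) lerXn2r ?nnegrE// (le_trans _ (hD k)).
Qed.

Lemma design_sqr_le (R : realType) (n p r : nat) (X : 'M[R]_(n, p)) (Pm : 'M[R]_(n, r))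
    (lam : 'rV[R]_r) (Qm : 'M[R]_(p, r)) (v : 'cV[R]_p) (L : R) :
  is_thin_svd X Pm lam Qm -> (forall k, lam 0 k <= L) ->
  \sum_(i < n) (X *m v) i 0 ^+ 2 <= L ^+ 2 * \sum_(j < p) v j 0 ^+ 2.
Proof.
move=> [XE PP QQ lam0 _] hL.
rewrite XE -!mulmxA (sum_sqr_orthonormal R n r Pm _ PP).
apply: (@le_trans _ _ (L ^+ 2 * \sum_(k < r) (Qm^T *m v) k 0 ^+ 2)).
  rewrite mulr_sumr; apply: ler_sum => k _.
  rewrite mul_diag_mx mxE exprMn ler_wpM2r ?sqr_ge0//.
  by rewrite lerXn2r ?nnegrE//; apply: ltW => //; exact: lt_le_trans (hL k).
by rewrite ler_wpM2l ?sqr_ge0// sum_sqr_proj_le.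
Qed.

Lemma design_theta (R : realType) (n p r : nat) (X : 'M[R]_(n, p)) (Pm : 'M[R]_(n, r))
    (lam : 'rV[R]_r) (Qm : 'M[R]_(p, r)) (beta : 'cV[R]_p) :
  is_thin_svd X Pm lam Qm -> X *m theta Qm beta = X *m beta.
Proof.
by move=> [-> _ QQ _ _]; rewrite /theta -!mulmxA (mulmxA Qm^T) QQ mul1mx.
Qed.

(** * Tail bounds *)

Section probability_bounds.
Context d (T : measurableType d) (R : realType) (P : probability T R).
Local Open Scope classical_set_scope.
Local Open Scope ring_scope.

Lemma measurable_set_lt_norm (X : T -> R) (t : R) : measurable_fun setT X ->
  measurable [set w | t < `|X w|].
Proof.
move=> mX; rewrite -[X in measurable X]setTI.
have m1 : measurable_fun setT (fun w => `|X w|) by exact: measurableT_comp.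
rewrite (_ : [set w | _] = (fun w => `|X w|) @^-1` `]t, +oo[); last first.
  by apply/seteqP; split=> w /=; rewrite in_itv /= andbT.
exact: m1.
Qed.

Lemma markov_powR (X : T -> R) (m t B : R) : measurable_fun setT X -> 0 < m -> 0 < t ->
  (\int[P]_w (`|X w| `^ m)%:E <= B%:E)%E ->
  (P [set w | (t < `|X w|)%R] <= (B / t `^ m)%:E)%E.
Proof.
move=> mX m0 t0 hB.
have mg : measurable_fun setT (fun w => (`|X w| `^ m)%:E).
  by apply/measurable_EFinP; apply: (measurableT_comp (measurable_normr_powR R m)).
have tm : 0 < t `^ m by exact: powR_gt0.
rewrite EFinM lee_pdivlMr// muleC.
apply: le_trans hB.
have := le_integral_abse P measurableT mg tm; rewrite setTI.
under eq_integral do rewrite gee0_abs ?lee_fin ?powR_ge0//.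
apply: le_trans; rewrite lee_wpmul2l ?lee_fin ?powR_ge0//.
apply: le_measure; rewrite ?inE; first exact: measurable_set_lt_norm.
- rewrite -[X in measurable X]setTI.
  by apply: emeasurable_fun_c_infty => //; exact: measurableT_comp.
- move=> w /= tX; rewrite lee_fin ger0_norm ?powR_ge0//.
  by rewrite ge0_ler_powR ?nnegrE//; exact: ltW.
Qed.

Lemma probability_bigsetU_le (I : finType) (Q : pred I) (F : I -> set T) (c : R) :
  (forall i, measurable (F i)) -> (forall i, Q i -> (P (F i) <= c%:E)%E) ->
  (P (\big[setU/set0]_(i | Q i) F i) <= (#|Q|%:R * c)%:E)%E.
Proof.
move=> mF hF.
have -> : (#|Q|%:R * c)%:E = (\sum_(i | Q i) c%:E)%E.
  by rewrite sumEFin sumr_const mulr_natl.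
suff : measurable (\big[setU/set0]_(i | Q i) F i) /\
   (P (\big[setU/set0]_(i | Q i) F i) <= \sum_(i | Q i) c%:E)%E by case.
apply: (big_ind2 (fun (A : set T) (x : \bar R) => measurable A /\ (P A <= x)%E)).
- by split; rewrite ?measure0.
- move=> A x B y [mA hA] [mB hB]; split; first exact: measurableU.
  by apply: (le_trans (measureU2 _ mA mB)); exact: leeD.
- by move=> i Qi; split => //; exact: hF.
Qed.

Lemma probability_le_setU (A B C : set T) (x y : R) : measurable A -> measurable B ->
  measurable C -> A `<=` B `|` C -> (P B <= x%:E)%E -> (P C <= y%:E)%E ->
  (P A <= (x + y)%:E)%E.
Proof.
move=> mA mB mC AB hB hC.
apply: (@le_trans _ _ (P (B `|` C))).
  by apply: le_measure; rewrite ?inE//; exact: measurableU.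
by apply: (le_trans (measureU2 _ mB mC)); rewrite EFinD leeD.
Qed.

(** Needed for the centered squares of the errors, to which the moment inequality is applied as
    well. *)
Lemma iid_comp (Z : nat -> {mfun T >-> R}) (g : R -> R) : measurable_fun setT g ->
  indep_family P Z -> ident_family P Z ->
  exists Y : nat -> {mfun T >-> R}, (forall i w, Y i w = g (Z i w)) /\
    indep_family P Y /\ ident_family P Y.
Proof.
move=> mg indZ idZ.
have mY i : measurable_fun setT (g \o Z i) by exact: measurableT_comp.
pose Y i : {mfun T >-> R} := mfun_Sub (mem_set (mY i)).
exists Y; split => //.
have YE i (A : set R) : Y i @^-1` A = Z i @^-1` (g @^-1` A) by [].
have mgA (A : set R) : measurable A -> measurable (g @^-1` A).
  by move=> mA; rewrite -[X in measurable X]setTI; exact: mg.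
split.
- move=> S A uS mA; under eq_bigr do rewrite YE; rewrite (indZ _ (fun i => g @^-1` A i))//.
  by move=> i; exact: mgA.
- by move=> i A mA; rewrite !YE; apply: idZ; exact: mgA.
Qed.

End probability_bounds.

Lemma moment_weighted_sum_ord d (T : measurableType d) (R : realType) (P : probability T R)
    (Z : nat -> {mfun T >-> R}) (m : R) :
  2 <= m -> indep_family P Z -> ident_family P Z ->
  (\int[P]_w (Z 0%N w)%:E = 0)%E ->
  (\int[P]_w (`|Z 0%N w| `^ m)%:E < +oo)%E ->
  exists K : R, 0 < K /\ forall (n : nat) (a : 'I_n -> R) (A : R), 0 < A ->
    \sum_(i < n) a i ^+ 2 <= A ->
    (\int[P]_w (`|\sum_(i < n) a i * Z i w| `^ m)%:E <= (K * A `^ (m / 2))%:E)%E.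
Proof.
move=> m2 indZ idZ EZ EZm.
have [K [K0 hK]] := moment_weighted_sum _ _ _ _ _ _ m2 indZ idZ EZ EZm.
exists K; split => // n a A A0 hA.
pose b k := if insub k is Some i then a i else 0.
have bE (i : 'I_n) : b i = a i by rewrite /b valK.
have := hK b n A A0; under eq_bigr do rewrite bE.
move=> /(_ hA); apply: le_trans; rewrite le_eqVlt; apply/orP; left; apply/eqP.
by apply: eq_integral => w _; under [in RHS]eq_bigr do rewrite bE.
Qed.

Lemma powR_norm_sub_le (R : realType) (m a b : R) : 0 <= m ->
  `|a - b| `^ m <= 2 `^ m * (`|a| `^ m + `|b| `^ m).
Proof.
move=> m0; have ha := powR_ge0 `|a| m; have hb := powR_ge0 `|b| m.
have h2 : 0 <= 2 `^ m :> R by exact: powR_ge0.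
have [ab|ba] := leP `|a| `|b|.
- have h : `|a - b| `^ m <= 2 `^ m * `|b| `^ m.
    rewrite -powRM// ge0_ler_powR ?nnegrE//; apply: (le_trans (ler_normB _ _)); lra.
  by apply: (le_trans h); rewrite ler_wpM2l// lerDr.
- have h : `|a - b| `^ m <= 2 `^ m * `|a| `^ m.
    rewrite -powRM// ge0_ler_powR ?nnegrE//; apply: (le_trans (ler_normB _ _)); lra.
  by apply: (le_trans h); rewrite ler_wpM2l// lerDl.
Qed.

Lemma powR_norm_le_sqr (R : realType) (m a A : R) : 0 <= m -> a ^+ 2 <= A ->
  `|a| `^ m <= A `^ (m / 2).
Proof.
move=> m0 aA.
have -> : `|a| `^ m = (a ^+ 2) `^ (m / 2).
  by rewrite -(real_normK (num_real a)) -powR_mulrn// -powRrM; congr (_ `^ _); field.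
by rewrite ge0_ler_powR ?nnegrE ?sqr_ge0//; [rewrite divr_ge0|apply: le_trans aA; exact: sqr_ge0].
Qed.

Lemma measurable_ridge_error_dot d (T : measurableType d) (R : realType) (P : probability T R)
    (eps : nat -> {RV P >-> R}) (n p r : nat) (Pm : 'M[R]_(n, r))
    (lam : 'rV[R]_r) (Qm : 'M[R]_(p, r)) (rho : R) (beta : 'cV[R]_p) (c : 'I_r -> R) :
  measurable_fun setT (fun w => \sum_(k < r) c k *
    ridge_error Pm lam Qm rho beta (epsvec eps n w) k 0).
Proof.
under eq_fun do rewrite ridge_error_dot.
apply: measurable_funB => //.
apply: measurable_sum => l; under eq_fun do rewrite mxE.
by apply: measurable_funM => //; exact: measurable_funPT.
Qed.

Lemma ridge_error_moment d (T : measurableType d) (R : realType) (P : probability T R)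
    (eps : nat -> {RV P >-> R}) (m : R) :
  2 <= m -> iid_seq eps ->
  (\int[P]_w (eps 0%N w)%:E = 0)%E ->
  (\int[P]_w (`|eps 0%N w| `^ m)%:E < +oo)%E ->
  exists K : R, 0 < K /\ forall (n p r : nat) (Pm : 'M[R]_(n, r))
    (lam : 'rV[R]_r) (Qm : 'M[R]_(p, r)) (rho : R) (beta : 'cV[R]_p) (c : 'I_r -> R) (A : R),
    0 < A ->
    \sum_(l < n) (\sum_(k < r) c k * ridge_weight lam rho 0 k * Pm l k) ^+ 2 <= A ->
    (\sum_(k < r) c k * ridge_bias lam rho 0 k * (Qm^T *m beta) k 0) ^+ 2 <= A ->
    (\int[P]_w (`|\sum_(k < r) c k *
        ridge_error Pm lam Qm rho beta (epsvec eps n w) k 0| `^ m)%:E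
      <= (K * A `^ (m / 2))%:E)%E.
Proof.
move=> m2 [indZ idZ] EZ EZm; have m0 : 0 <= m by lra.
have [K [K0 hK]] := moment_weighted_sum_ord _ _ _ _ _ _ m2 indZ idZ EZ EZm.
have h2 : 0 < 2 `^ m :> R by exact: powR_gt0.
(* [K] pays for the noise, 1 for the deterministic bias, and the power of 2 for splitting their
   difference. *)
exists (2 `^ m * (K + 1)); split; first by rewrite mulr_gt0// addr_gt0.
move=> n p r Pm lam Qm rho beta c A A0 hA hB.
set b := \sum_(k < r) c k * ridge_bias lam rho 0 k * _ in hB.
pose a (l : 'I_n) := \sum_(k < r) c k * ridge_weight lam rho 0 k * Pm l k.
have mS : measurable_fun setT (fun w => \sum_(i < n) a i * eps i w).
  by apply: measurable_sum => l; apply: measurable_funM => //; exact: measurable_funPT.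
have mSm : measurable_fun setT (fun w => (`|\sum_(i < n) a i * eps i w| `^ m)%:E).
  by apply/measurable_EFinP; apply: (measurableT_comp (measurable_normr_powR R m)).
apply: (@le_trans _ _ (\int[P]_w ((2 `^ m)%:E *
    ((`|\sum_(i < n) a i * eps i w| `^ m)%:E + (A `^ (m / 2))%:E)))%E).
  apply: ge0_le_integral => //.
  - apply/measurable_EFinP; apply: (measurableT_comp (measurable_normr_powR R m)).
    exact: measurable_ridge_error_dot.
  - by apply: emeasurable_funM => //; exact: emeasurable_funD.
  - move=> w _; rewrite -EFinD -EFinM lee_fin ridge_error_dot.
    have -> : \sum_(l < n) (\sum_(k < r) c k * ridge_weight lam rho 0 k * Pm l k) *
        epsvec eps n w l 0 = \sum_(i < n) a i * eps i w.
      by apply: eq_bigr => l _; rewrite mxE.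
    apply: (le_trans (powR_norm_sub_le _ m _ b m0)).
    by rewrite ler_pM2l// lerD2l powR_norm_le_sqr.
rewrite ge0_integralZl//; last 2 first.
  - by apply: emeasurable_funD.
  - by move=> w _; apply: adde_ge0; rewrite lee_fin powR_ge0.
rewrite ge0_integralD//; last by move=> w _; rewrite lee_fin powR_ge0.
rewrite integral_cst// [X in (_ * (_ + _ * X))%E]probability_setT mule1.
apply: (@le_trans _ _ ((2 `^ m)%:E * ((K * A `^ (m / 2))%:E + (A `^ (m / 2))%:E))%E).
  by rewrite lee_pmul2l// leeD2r// hK.
by rewrite -EFinD -EFinM lee_fin mulrDr mulrDr mulrDl mulr1 mulrA.
Qed.

(** * Rates *)

Lemma eventually_and (Q1 Q2 : nat -> Prop) :
  eventually_nat Q1 -> eventually_nat Q2 -> eventually_nat (fun n => Q1 n /\ Q2 n).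
Proof.
move=> [N1 h1] [N2 h2]; exists (maxn N1 N2) => n; rewrite geq_max => /andP[n1 n2].
by split; [exact: h1|exact: h2].
Qed.

Lemma eventually_mono (Q1 Q2 : nat -> Prop) :
  (forall n, Q1 n -> Q2 n) -> eventually_nat Q1 -> eventually_nat Q2.
Proof. by move=> h [N hN]; exists N => n /hN /h. Qed.

Lemma eventually_ge (N : nat) : eventually_nat (fun n => (N <= n)%N).
Proof. by exists N. Qed.

Lemma npow_gt0 (R : realType) (n : nat) (a : R) : (0 < n)%N -> 0 < npow n a.
Proof. by move=> n0; rewrite /npow powR_gt0// ltr0n. Qed.

Lemma npowD (R : realType) (n : nat) (a b : R) : (0 < n)%N ->
  npow n (a + b) = npow n a * npow n b.
Proof. by move=> n0; rewrite /npow powRD// pnatr_eq0 -lt0n n0 implybT. Qed.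

Lemma npowN (R : realType) (n : nat) (a : R) : npow n (- a) = (npow n a)^-1.
Proof. by rewrite /npow powRN. Qed.

Lemma npowX (R : realType) (n : nat) (a b : R) : npow n a `^ b = npow n (a * b).
Proof. by rewrite /npow powRrM. Qed.

Lemma npow_sqr (R : realType) (n : nat) (a : R) : npow n a ^+ 2 = npow n (2 * a).
Proof. by rewrite -powR_mulrn ?powR_ge0// npowX mulrC. Qed.

Lemma npow1 (R : realType) (n : nat) : npow n 1 = n%:R :> R.
Proof. by rewrite /npow powRr1. Qed.

Lemma npow0 (R : realType) (n : nat) : npow n 0 = 1 :> R.
Proof. by rewrite /npow powRr0. Qed.

Lemma ler_npow (R : realType) (n : nat) (a b : R) : (0 < n)%N -> a <= b -> npow n a <= npow n b.
Proof. by move=> n0 ab; rewrite /npow ler_powR// ler1n. Qed.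

Lemma npow_small (R : realType) (x e : R) : 0 < x -> 0 < e ->
  eventually_nat (fun n => npow n (- x) <= e).
Proof.
move=> x0 e0; pose y := e^-1 `^ x^-1.
have y0 : 0 <= y by exact: powR_ge0.
exists (Num.truncn y).+1 => n hn.
have yn : y <= n%:R by apply: ltW; apply: lt_le_trans (truncnS_gt y) _; rewrite ler_nat.
have n0 : (0 < n)%N by exact: leq_trans hn.
rewrite npowN invf_ple ?posrE ?npow_gt0//.
have -> : e^-1 = y `^ x by rewrite -powRrM mulVf ?gt_eqF// powRr1// invr_ge0 ltW.
by rewrite ge0_ler_powR ?nnegrE// ltW.
Qed.

Lemma ridge_weight_le (R : realType) (l rho : R) : 0 < l -> 0 < rho ->
  `|l / (l ^+ 2 + rho) + rho * l / (l ^+ 2 + rho) ^+ 2| <= 2 / l.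
Proof.
move=> l0 rho0; set s := l ^+ 2 + rho.
have ls : l ^+ 2 <= s by rewrite lerDl ltW.
have rs : rho <= s by rewrite lerDr sqr_ge0.
have s0 : 0 < s by rewrite (lt_le_trans rho0).
have h1 : l / s <= 1 / l.
  by rewrite ler_pdivrMr// mulrAC mul1r ler_pdivlMr// -expr2.
have h2 : rho * l / s ^+ 2 <= 1 / l.
  rewrite (_ : rho * l / s ^+ 2 = (rho / s) * (l / s)); last by field; rewrite gt_eqF.
  have h : rho / s <= 1 by rewrite ler_pdivrMr// mul1r.
  by apply: le_trans h1; rewrite ler_piMl// divr_ge0// ltW.
have h3 : 0 <= rho * l / s ^+ 2 by rewrite divr_ge0 ?sqr_ge0// mulr_ge0// ltW.
have h4 : 0 <= l / s by rewrite divr_ge0// ltW.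
rewrite ger0_norm ?addr_ge0//; lra.
Qed.

Lemma ridge_bias_le (R : realType) (l rho : R) : 0 < l -> 0 < rho ->
  `|(rho / (l ^+ 2 + rho)) ^+ 2| <= (rho / l ^+ 2) ^+ 2.
Proof.
move=> l0 rho0.
have l20 : 0 < l ^+ 2 by rewrite exprn_gt0.
rewrite ger0_norm ?sqr_ge0// lerXn2r ?nnegrE ?divr_ge0 ?addr_ge0 ?ltW//.
by rewrite ltr_pM2l// ltf_pV2 ?posrE ?addr_gt0// ltrDl.
Qed.

Lemma ridge_rates (R : realType) (p r : nat -> nat) (X : forall n : nat, 'M[R]_(n, p n))
    (beta : forall n : nat, 'cV[R]_(p n)) (Pm : forall n : nat, 'M[R]_(n, r n))
    (lam : forall n : nat, 'rV[R]_(r n)) (Qm : forall n : nat, 'M[R]_(p n, r n))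
    (rho : nat -> R) (c_lam eta alpha_theta delta : R) :
  (forall n, is_thin_svd (X n) (Pm n) (lam n) (Qm n)) ->
  0 < c_lam ->
  eventually_nat (fun n => forall k : 'I_(r n), c_lam * npow n eta <= lam n 0 k) ->
  bigO_seq (fun n => Num.sqrt (\sum_(i < p n) (theta (Qm n) (beta n) i 0) ^+ 2))
    (fun n => npow n alpha_theta) ->
  (forall n, 0 < rho n) ->
  bigO_seq rho (fun n => npow n (2 * eta - delta)) ->
  (eta + alpha_theta) / 2 < delta ->
  exists C : R, 0 < C /\ eventually_nat (fun n => forall (c : 'I_(r n) -> R) (S : R),
    \sum_(k < r n) c k ^+ 2 <= S ->
    \sum_(l < n) (\sum_(k < r n) c k * ridge_weight (lam n) (rho n) 0 k * Pm n l k) ^+ 2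
      <= C * npow n (- (2 * eta)) * S /\
    (\sum_(k < r n) c k * ridge_bias (lam n) (rho n) 0 k * ((Qm n)^T *m beta n) k 0) ^+ 2
      <= C * npow n (- (2 * eta)) * S).
Proof.
move=> svd c0 hlam [Ct [Ct0 hth]] rho0 [Cr [Cr0 hrho]] hdelta.
have c2 : 0 < c_lam ^+ 2 by rewrite exprn_gt0.
pose B := (Cr / c_lam ^+ 2) ^+ 2.
have B0 : 0 < B by rewrite exprn_gt0// divr_gt0.
(* [C1] comes from w_k <= 2 / lam_k. [B] is the constant in the bound on the bias entries, and [C2]
   joins it to the norm of theta. Their sum serves noise and bias at once, as a common rate is all
   that the moment bound needs. *)
pose C1 := (2 / c_lam) ^+ 2; pose C2 := B ^+ 2 * Ct ^+ 2.
have C10 : 0 < C1 by rewrite exprn_gt0// divr_gt0.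
have C20 : 0 < C2 by apply: mulr_gt0; apply: exprn_gt0.
exists (C1 + C2); split; first exact: addr_gt0.
move: (eventually_and _ _ (eventually_and _ _ hlam hth) (eventually_and _ _ hrho (eventually_ge 1))).
apply: eventually_mono => n [[hl ht] [hr n0]] c S hS.
have [XE PP QQ lam0 _] := svd n.
have c20 : 0 <= \sum_(k < r n) c k ^+ 2 by apply: sumr_ge0 => k _; exact: sqr_ge0.
have S0 : 0 <= S by exact: le_trans hS.
have ne0 : 0 < npow n eta by exact: npow_gt0.
have nm0 : 0 < npow n (- (2 * eta)) by exact: npow_gt0.
split.
- have hw k : `|ridge_weight (lam n) (rho n) 0 k| <= 2 / c_lam * npow n (- eta).
    rewrite mxE; apply: (le_trans (ridge_weight_le _ _ _ (lam0 k) (rho0 n))).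
    by rewrite npowN -mulrA -invfM ler_pM2l// lef_pV2 ?posrE// mulr_gt0.
  apply: (le_trans (ridge_noise_sqr_le _ _ _ _ _ _ _ PP hw)).
  rewrite exprMn npow_sqr mulrN -/C1.
  apply: (@le_trans _ _ (C1 * npow n (- (2 * eta)) * S)).
    by rewrite ler_wpM2l// mulr_ge0// ltW.
  by rewrite ler_wpM2r// ler_wpM2r ?ltW// ltrDl.
- have hD k : `|ridge_bias (lam n) (rho n) 0 k| <= B * npow n (- (2 * delta)).
    rewrite mxE; apply: (le_trans (ridge_bias_le _ _ _ (lam0 k) (rho0 n))).
    rewrite /B -mulrN -npow_sqr -exprMn lerXn2r ?nnegrE//.
    - by rewrite divr_ge0 ?sqr_ge0// ltW.
    - by rewrite mulr_ge0 ?divr_ge0 ?ltW// npow_gt0.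
    have hr' : rho n <= Cr * npow n (2 * eta - delta) by apply: le_trans hr; exact: ler_norm.
    have hl2 : c_lam ^+ 2 * npow n (2 * eta) <= lam n 0 k ^+ 2.
      rewrite -npow_sqr -exprMn lerXn2r ?nnegrE//; last exact: ltW.
      by apply: mulr_ge0; exact: ltW.
    rewrite ler_pdivrMr ?exprn_gt0//; apply: (le_trans hr').
    apply: (@le_trans _ _ (Cr / c_lam ^+ 2 * npow n (- delta) * (c_lam ^+ 2 * npow n (2 * eta)))).
      rewrite le_eqVlt; apply/orP; left; apply/eqP.
      by rewrite npowD//; field; rewrite gt_eqF.
    by rewrite ler_wpM2l// mulr_ge0 ?divr_ge0 ?ltW// npow_gt0.
  apply: (le_trans (ridge_bias_sqr_le _ _ _ _ _ _ _ _ QQ hD)).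
  have hth2 : \sum_(j < p n) theta (Qm n) (beta n) j 0 ^+ 2 <= Ct ^+ 2 * npow n (2 * alpha_theta).
    have s0 : 0 <= \sum_(j < p n) theta (Qm n) (beta n) j 0 ^+ 2.
      by apply: sumr_ge0 => k _; exact: sqr_ge0.
    rewrite -(sqr_sqrtr s0) -npow_sqr -exprMn lerXn2r ?nnegrE ?sqrtr_ge0//.
      by rewrite mulr_ge0 ?ltW// npow_gt0.
    by apply: le_trans ht; exact: ler_norm.
  apply: (@le_trans _ _ (C2 * npow n (- (2 * eta)) * S)); last first.
    by rewrite ler_wpM2r// ler_wpM2r ?ltW// ltrDr.
  rewrite exprMn npow_sqr.
  have n4 : 0 < npow n (2 * - (2 * delta)) by exact: npow_gt0.
  apply: (@le_trans _ _ (B ^+ 2 * npow n (2 * - (2 * delta)) * S *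
      (Ct ^+ 2 * npow n (2 * alpha_theta)))).
    apply: ler_pM => //.
    - by rewrite mulr_ge0// mulr_ge0 ?sqr_ge0// ltW.
    - by apply: sumr_ge0 => k _; exact: sqr_ge0.
    - by rewrite ler_wpM2l// mulr_ge0 ?sqr_ge0// ltW.
  rewrite (_ : _ * _ = C2 * (npow n (2 * - (2 * delta)) * npow n (2 * alpha_theta)) * S); last first.
    by rewrite /C2; ring.
  rewrite -npowD// ler_wpM2r// ler_pM2l// ler_npow//; lra.
Qed.

(** A wrong decision on coordinate i puts the estimate on the other side of the threshold b, while
    the true value is at distance at least (1 - c_b) b from it on either side. Half of that gap
    leaves room for the strict inequality. *)
Lemma selection_error_gt (R : realType) (p : nat) (b c_b : R) (th tt : 'cV[R]_p) :
  0 < b -> 0 < c_b < 1 ->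
  (forall i, i \notin Nset b th -> `|th i 0| <= c_b * b) ->
  (forall i, i \in Nset b th -> b / c_b <= `|th i 0|) ->
  Nset b tt != Nset b th -> exists i, (1 - c_b) * b / 2 < `|tt i 0 - th i 0|.
Proof.
move=> b0 /andP[c0 c1] hout hin hN; apply: contrapT => hno.
have hle i : `|tt i 0 - th i 0| <= (1 - c_b) * b / 2.
  by rewrite leNgt; apply/negP => h; apply: hno; exists i.
move/negP: hN; apply; apply/eqP/setP => i; apply/idP/idP => hi.
- apply: contraT => /hout h1; move: hi; rewrite inE => h2.
  have := hle i; have := ler_normB (tt i 0 - th i 0) (- th i 0).
  rewrite opprK subrK normrN; have : 0 < (1 - c_b) * b by rewrite mulr_gt0// subr_gt0.
  lra.
- have h1 := hin i hi; rewrite inE.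
  have hb : 0 < (1 - c_b) * b by rewrite mulr_gt0// subr_gt0.
  (* After division by b and multiplication by c_b this is (1 - c_b)^2 >= 0. *)
  have h3 : b + (1 - c_b) * b <= b / c_b.
    rewrite ler_pdivlMr//; have := sqr_ge0 (1 - c_b); nra.
  have := hle i; have := ler_normB (tt i 0) (tt i 0 - th i 0).
  rewrite opprB addrCA subrr addr0; lra.
Qed.

(** * Measurability and error decompositions *)

Lemma bigsetU_finP (T : Type) (I : finType) (Q : pred I) (F : I -> set T) (w : T) :
  (\big[setU/set0]_(i | Q i) F i)%classic w <-> exists2 i, Q i & F i w.
Proof.
split; last by move=> [i Qi Fi]; rewrite (bigD1 i)//=; left.
apply: (big_ind (fun A : set T => A w -> exists2 i, Q i & F i w)) => //.
  by move=> A B hA hB [/hA|/hB].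
by move=> i Qi Fi; exists i.
Qed.

Section measurability.
Context d (T : measurableType d) (R : realType).
Local Open Scope classical_set_scope.
Local Open Scope ring_scope.

(** The deviation events in the conclusions must be measurable before monotonicity of [P] can
    compare them with the exceptional events. *)
Lemma measurable_maxabs (q : nat) (v : T -> 'cV[R]_q) :
  (forall i, measurable_fun setT (fun w => v w i 0)) ->
  measurable_fun setT (fun w => maxabs (v w)).
Proof.
move=> mv; rewrite /maxabs; elim: (index_enum _) => [|i s ih].
  by under eq_fun do rewrite big_nil; exact: measurable_cst.
under eq_fun do rewrite big_cons.
have mi : measurable_fun setT (fun w => `|v w i 0|) by exact: measurableT_comp.
apply: measurable_fun_ifT => //; exact: measurable_fun_ltr.
Qed.

Lemma measurable_theta_hat (p : nat) (b : R) (tt : T -> 'cV[R]_p) :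
  (forall i, measurable_fun setT (fun w => tt w i 0)) ->
  forall i, measurable_fun setT (fun w => theta_hat b (tt w) i 0).
Proof.
move=> mt i; under eq_fun do rewrite mxE inE.
have mi : measurable_fun setT (fun w => `|tt w i 0|) by exact: measurableT_comp.
by apply: measurable_fun_ifT => //; exact: measurable_fun_ltr.
Qed.

Lemma measurable_mulmx_cV (q p : nat) (M : 'M[R]_(q, p)) (v : T -> 'cV[R]_p) :
  (forall i, measurable_fun setT (fun w => v w i 0)) ->
  forall i, measurable_fun setT (fun w => (M *m v w) i 0).
Proof.
move=> mv i; under eq_fun do rewrite mxE.
by apply: measurable_sum => j; apply: measurable_funM.
Qed.

Lemma measurable_sigma2_hat (n p : nat) (X : 'M[R]_(n, p)) (y : T -> 'cV[R]_n)
    (th : T -> 'cV[R]_p) :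
  (forall i, measurable_fun setT (fun w => y w i 0)) ->
  (forall i, measurable_fun setT (fun w => th w i 0)) ->
  measurable_fun setT (fun w => sigma2_hat X (y w) (th w)).
Proof.
move=> my mth; apply: measurable_funM => //; apply: measurable_sum => i.
apply: measurable_funX; apply: measurable_funB; first exact: my.
exact: measurable_mulmx_cV.
Qed.

Lemma measurable_Nset_neq (p : nat) (b : R) (N : {set 'I_p}) (tt : T -> 'cV[R]_p) :
  (forall i, measurable_fun setT (fun w => tt w i 0)) ->
  measurable [set w | Nset b (tt w) != N].
Proof.
move=> mt.
rewrite (_ : [set w | _] = \big[setU/set0]_(i : 'I_p) [set w | (b < `|tt w i 0|) != (i \in N)]).
  apply: bigsetU_measurable => i _; case: (i \in N).
  - rewrite (_ : [set w | _] = ~` [set w | b < `|tt w i 0|]).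
      by apply: measurableC; exact: measurable_set_lt_norm.
    by apply/seteqP; split=> w /=; case: (b < _).
  - rewrite (_ : [set w | _] = [set w | b < `|tt w i 0|]).
      exact: measurable_set_lt_norm.
    by apply/seteqP; split=> w /=; case: (b < _).
apply/seteqP; split=> w.
- move=> /= hN; apply/bigsetU_finP; apply: contrapT => hno.
  move/negP: hN; apply; apply/eqP/setP => i; rewrite inE.
  by apply/eqP; apply: contrapT => hi; apply: hno; exists i => //; apply/negP.
- move=> /bigsetU_finP[i _] /=; apply: contraNN => /eqP <-.
  by rewrite inE.
Qed.

End measurability.

Lemma maxabs_ge0 (R : realType) (q : nat) (v : 'cV[R]_q) : 0 <= maxabs v.
Proof.
by apply: (big_ind (fun x : R => 0 <= x)) => // x y x0 y0; rewrite le_max x0.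
Qed.

Lemma norm_le_maxabs (R : realType) (q : nat) (v : 'cV[R]_q) (i : 'I_q) : `|v i 0| <= maxabs v.
Proof. exact: (@le_bigmax _ _ _ 0 (fun i => `|v i 0|) i). Qed.

Lemma maxabs_le (R : realType) (q : nat) (v : 'cV[R]_q) (t : R) :
  0 <= t -> (forall i, `|v i 0| <= t) -> maxabs v <= t.
Proof. by move=> t0 h; apply: bigmax_le. Qed.

(** As beta = theta + theta_perp, three errors remain under correct selection: estimation on the
    selected set, the signal removed by thresholding, and the part of beta that the design cannot
    see. Only the first one is random. *)
Lemma gamma_error_decomp (R : realType) (p1 p r : nat) (M : 'M[R]_(p1, p)) (Qm : 'M[R]_(p, r))
    (beta tt : 'cV[R]_p) (u : 'cV[R]_r) (b : R) (i : 'I_p1) :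
  tt = theta Qm beta + Qm *m u -> Nset b tt = Nset b (theta Qm beta) ->
  let N := Nset b (theta Qm beta) in
  (M *m theta_hat b tt - M *m beta) i 0 =
  \sum_(k < r) cc M Qm N i k * u k 0 - \sum_(j < p | j \notin N) M i j * theta Qm beta j 0
  - (M *m theta_perp Qm beta) i 0.
Proof.
move=> tE NE N.
have -> : \sum_(k < r) cc M Qm N i k * u k 0 =
    \sum_(j in N) M i j * (Qm *m u) j 0.
  rewrite /cc; under eq_bigr do rewrite mulr_suml.
  rewrite exchange_big /=; apply: eq_bigr => j _.
  by rewrite [(Qm *m u) j 0]mxE mulr_sumr; apply: eq_bigr => k _; rewrite mulrA.
have hE j : theta_hat b tt j 0 = if j \in N then tt j 0 else 0 by rewrite mxE NE.
rewrite -mulmxBr; move: (theta_hat b tt) hE => h hE.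
rewrite [(M *m (h - beta)) i 0]mxE [(M *m theta_perp _ _) i 0]mxE.
rewrite [in RHS]big_mkcond /= [X in _ - X - _]big_mkcond /= -!sumrB; apply: eq_bigr => j _.
rewrite [(h - beta) j 0]mxE hE tE /theta_perp.
move: (theta Qm beta) (Qm *m u) => t v.
rewrite !mxE; case: (j \in N) => /=; ring.
Qed.

(* The cross term is split by AM-GM with weight [tau]: Cauchy-Schwarz is not needed when [h] is of
   order [tau] in mean square. *)
Lemma sqr_dev_le (R : realType) (n : nat) (e g h : 'I_n -> R) (s2 tau : R) :
  (0 < n)%N -> 0 < tau <= 1 ->
  `|n%:R^-1 * \sum_(i < n) (e i + g i - h i) ^+ 2 - s2| <=
    3 * `|\sum_(i < n) n%:R^-1 * (e i ^+ 2 - s2)|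
    + 2 * `|\sum_(i < n) n%:R^-1 * g i * e i|
    + 3 * (n%:R^-1 * \sum_(i < n) g i ^+ 2) + 2 * tau * `|s2|
    + 2 / tau * (n%:R^-1 * \sum_(i < n) h i ^+ 2).
Proof.
move=> n0 /andP[t0 t1].
have nn : (n%:R : R) != 0 by rewrite pnatr_eq0 -lt0n.
set k := n%:R^-1.
have k0 : 0 < k by rewrite invr_gt0 ltr0n.
set S1 := \sum_(i < n) k * _; set S2 := \sum_(i < n) k * g i * e i.
set G := k * \sum_i g i ^+ 2; set H := k * \sum_i h i ^+ 2.
pose X := k * \sum_(i < n) 2 * (e i + g i) * h i.
have G0 : 0 <= G by apply: mulr_ge0; [exact: ltW|apply: sumr_ge0 => i _; exact: sqr_ge0].
have H0 : 0 <= H by apply: mulr_ge0; [exact: ltW|apply: sumr_ge0 => i _; exact: sqr_ge0].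
have S1E : S1 = k * (\sum_i e i ^+ 2) - s2.
  rewrite /S1 -mulr_sumr sumrB sumr_const card_ord mulrBr -mulr_natl mulrA mulVf// mul1r.
  by [].
have S2E : S2 = k * (\sum_i g i * e i).
  by rewrite mulr_sumr; apply: eq_bigr => i _; rewrite mulrA.
have dE : k * \sum_(i < n) (e i + g i - h i) ^+ 2 - s2 = S1 + 2 * S2 + G - X + H.
  rewrite S1E S2E /G /X /H.
  have -> : \sum_(i < n) (e i + g i - h i) ^+ 2 =
      \sum_i e i ^+ 2 + 2 * (\sum_i g i * e i) + \sum_i g i ^+ 2
      - \sum_(i < n) 2 * (e i + g i) * h i + \sum_i h i ^+ 2.
    rewrite mulr_sumr -!big_split /= -sumrB -big_split /=; apply: eq_bigr => i _; ring.
  ring.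
have XE : `|X| <= 2 * tau * (k * (\sum_i e i ^+ 2) + G) + H / tau.
  have -> : 2 * tau * (k * (\sum_i e i ^+ 2) + G) + H / tau =
     k * (2 * tau * (\sum_i e i ^+ 2 + \sum_i g i ^+ 2) + (\sum_i h i ^+ 2) / tau).
    by rewrite /G /H; ring.
  rewrite /X normrM gtr0_norm// ler_pM2l//.
  apply: (le_trans (ler_norm_sum _ _ _)).
  rewrite mulr_suml -big_split mulr_sumr /= -big_split /=; apply: ler_sum => i _.
  have -> : `|2 * (e i + g i) * h i| = 2 * `|e i + g i| * `|h i|.
    by rewrite !normrM ger0_norm.
  have h1 : 2 * `|e i + g i| * `|h i| <= tau * `|e i + g i| ^+ 2 + `|h i| ^+ 2 / tau.
    rewrite -subr_ge0.
    have -> : tau * `|e i + g i| ^+ 2 + `|h i| ^+ 2 / tau - 2 * `|e i + g i| * `|h i| =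
        (tau * `|e i + g i| - `|h i|) ^+ 2 / tau by field; rewrite gt_eqF.
    by rewrite divr_ge0 ?sqr_ge0// ltW.
  rewrite !real_normK ?num_real// in h1.
  apply: (le_trans h1); rewrite lerD2r.
  by have := mulr_ge0 (ltW t0) (sqr_ge0 (e i - g i)); lra.
rewrite dE.
(* The mean of the squared errors is recovered from its own deviation [S1], so the cross term brings
   no further random quantity. *)
have h1 : k * (\sum_i e i ^+ 2) <= `|S1| + `|s2|.
  have -> : k * (\sum_i e i ^+ 2) = S1 + s2 by rewrite S1E subrK.
  by rewrite lerD// ler_norm.
have h2 : `|S1 + 2 * S2 + G - X + H| <= `|S1| + 2 * `|S2| + G + `|X| + H.
  apply: (le_trans (ler_normD _ _)); rewrite (ger0_norm H0) lerD2r.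
  apply: (le_trans (ler_normB _ _)); rewrite lerD2r.
  apply: (le_trans (ler_normD _ _)); rewrite (ger0_norm G0) lerD2r.
  apply: (le_trans (ler_normD _ _)); rewrite lerD2l normrM ger0_norm//.
apply: (le_trans h2).
have h3 : H <= H / tau by rewrite ler_pdivlMr// ler_piMr.
have h4 : tau * (k * (\sum_i e i ^+ 2) + G) <= tau * (`|S1| + `|s2| + G).
  by rewrite ler_pM2l// lerD2r.
have h5 : tau * `|S1| <= `|S1| by rewrite ler_piMl.
have h6 : tau * G <= G by rewrite ler_piMl.
have -> : 2 / tau * H = 2 * (H / tau) by ring.
move: XE; rewrite -mulrA => XE.
move: h4; rewrite !mulrDr => h4; move: XE; rewrite mulrDr => XE.
have -> : 2 * tau * `|s2| = 2 * (tau * `|s2|) by ring.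
lra.
Qed.

Lemma residual_decomp (R : realType) (n p r : nat) (X : 'M[R]_(n, p)) (Pm : 'M[R]_(n, r))
    (lam : 'rV[R]_r) (Qm : 'M[R]_(p, r)) (beta tt v : 'cV[R]_p) (e : 'cV[R]_n) (b : R) (i : 'I_n) :
  is_thin_svd X Pm lam Qm ->
  tt = theta Qm beta + v -> Nset b tt = Nset b (theta Qm beta) ->
  let N := Nset b (theta Qm beta) in
  yvec X beta e i 0 - (X *m theta_hat b tt) i 0 =
  e i 0 + (X *m \col_j (if j \in N then 0 else theta Qm beta j 0)) i 0
  - (X *m \col_j (if j \in N then v j 0 else 0)) i 0.
Proof.
move=> svd tE NE N.
have -> : theta_hat b tt = theta Qm beta - \col_j (if j \in N then 0 else theta Qm beta j 0)
    + \col_j (if j \in N then v j 0 else 0).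
  rewrite /theta_hat NE -/N tE; move: (theta Qm beta) => t.
  apply/colP => j; rewrite !mxE; case: (j \in N) => /=; ring.
rewrite /yvec mulmxDr mulmxBr (design_theta _ _ _ _ _ _ _ _ _ svd).
move: (X *m beta) (X *m _) (X *m _) => x y z.
rewrite !mxE; ring.
Qed.

(** * Selection consistency and the rate of the linear combinations *)

Lemma ridge_error_moment_rate d (T : measurableType d) (R : realType) (P : probability T R)
    (eps : nat -> {RV P >-> R}) (p r : nat -> nat) (beta : forall n : nat, 'cV[R]_(p n))
    (Pm : forall n : nat, 'M[R]_(n, r n)) (lam : forall n : nat, 'rV[R]_(r n))
    (Qm : forall n : nat, 'M[R]_(p n, r n)) (rho : nat -> R) (eta q C : R) :
  2 <= q -> iid_seq eps ->
  (\int[P]_w (eps 0%N w)%:E = 0)%E ->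
  (\int[P]_w (`|eps 0%N w| `^ q)%:E < +oo)%E ->
  0 < C ->
  eventually_nat (fun n => forall (c : 'I_(r n) -> R) (S : R),
    \sum_(k < r n) c k ^+ 2 <= S ->
    \sum_(l < n) (\sum_(k < r n) c k * ridge_weight (lam n) (rho n) 0 k * Pm n l k) ^+ 2
      <= C * npow n (- (2 * eta)) * S /\
    (\sum_(k < r n) c k * ridge_bias (lam n) (rho n) 0 k * ((Qm n)^T *m beta n) k 0) ^+ 2
      <= C * npow n (- (2 * eta)) * S) ->
  exists K : R, 0 < K /\ eventually_nat (fun n => forall (c : 'I_(r n) -> R) (S : R), 0 < S ->
    \sum_(k < r n) c k ^+ 2 <= S ->
    (\int[P]_w (`|\sum_(k < r n) c k * ridge_error (Pm n) (lam n) (Qm n) (rho n)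
        (beta n) (epsvec eps n w) k 0| `^ q)%:E
      <= (K * npow n (- (q * eta)) * S `^ (q / 2))%:E)%E).
Proof.
move=> q2 iid EZ Eq C0 hrate.
have [K [K0 hK]] := ridge_error_moment _ _ _ _ _ _ q2 iid EZ Eq.
exists (K * C `^ (q / 2)); split; first by rewrite mulr_gt0// powR_gt0.
apply: eventually_mono (eventually_and _ _ hrate (eventually_ge 1)) => n [h n0] c S S0 hS.
have [h1 h2] := h c S hS.
have np : 0 < npow n (- (2 * eta)) by exact: npow_gt0.
have A0 : 0 < C * npow n (- (2 * eta)) * S by rewrite !mulr_gt0.
apply: (le_trans (hK _ _ _ _ _ _ _ _ _ _ A0 h1 h2)); rewrite lee_fin.
rewrite powRM ?(ltW S0)//; last by rewrite mulr_ge0 ?(ltW C0) ?(ltW np).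
rewrite powRM ?(ltW C0) ?(ltW np)// npowX.
have -> : - (2 * eta) * (q / 2) = - (q * eta) by field.
by rewrite !mulrA lexx.
Qed.

Lemma selection_rate d (T : measurableType d) (R : realType) (P : probability T R)
    (p : nat -> nat) (th : forall n, 'cV[R]_(p n)) (tt : forall n, T -> 'cV[R]_(p n))
    (bn : nat -> R) (m eta K alpha_p C_b nu_b c_b : R) :
  0 < m -> 0 < K ->
  (forall n i, measurable_fun setT (fun w => tt n w i 0)) ->
  eventually_nat (fun n => forall i : 'I_(p n),
    (\int[P]_w (`|(tt n w - th n) i 0| `^ m)%:E <= (K * npow n (- (m * eta)))%:E)%E) ->
  bigO_seq (fun n => (p n)%:R) (fun n => npow n alpha_p) ->
  0 < C_b -> eventually_nat (fun n => bn n = C_b * npow n (- nu_b)) ->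
  0 < c_b < 1 ->
  eventually_nat (fun n => forall i : 'I_(p n),
      i \notin Nset (bn n) (th n) -> `|th n i 0| <= c_b * bn n) ->
  eventually_nat (fun n => forall i : 'I_(p n),
      i \in Nset (bn n) (th n) -> bn n / c_b <= `|th n i 0|) ->
  exists C : R, 0 < C /\ eventually_nat (fun n =>
    (P [set w | Nset (bn n) (tt n w) != Nset (bn n) (th n)]%classic
      <= (C * npow n (alpha_p + m * nu_b - m * eta))%:E)%E).
Proof.
move=> m0 K0 mt hE [Cp [Cp0 hp]] Cb0 hb /andP[c0 c1] hout hin.
(* The gap of [selection_error_gt] at b = C_b n^(-nu_b), up to the power of n. *)
pose k := (1 - c_b) * C_b / 2.
have k0 : 0 < k by rewrite divr_gt0// mulr_gt0// subr_gt0.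
have km : 0 < k `^ m by exact: powR_gt0.
exists (Cp * (K / k `^ m)); split; first by rewrite mulr_gt0// divr_gt0.
move: (eventually_and _ _ (eventually_and _ _ hE hp) (eventually_and _ _ (eventually_and _ _ hb hout)
  (eventually_and _ _ hin (eventually_ge 1)))).
apply: eventually_mono => n [[hEn hpn] [[hbn houtn] [hinn n0]]].
have nnb : 0 < npow n (- nu_b) by exact: npow_gt0.
have b0 : 0 < bn n by rewrite hbn mulr_gt0.
have c01 : 0 < c_b < 1 by rewrite c0.
pose t := k * npow n (- nu_b).
have t0 : 0 < t by exact: mulr_gt0.
have md i : measurable_fun setT (fun w => (tt n w - th n) i 0).
  by under eq_fun do rewrite 2!mxE; exact: measurable_funB.
have mF i : measurable [set w | t < `|(tt n w - th n) i 0|]%classic.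
  exact: measurable_set_lt_norm.
have tE : (1 - c_b) * bn n / 2 = t by rewrite hbn /t /k; ring.
apply: (@le_trans _ _ (P (\big[setU/set0]_(i : 'I_(p n))
    [set w | t < `|(tt n w - th n) i 0|]%classic)%classic)).
  apply: le_measure; rewrite ?inE.
  - exact: measurable_Nset_neq.
  - by apply: bigsetU_measurable => i _; exact: mF.
  - move=> w /= hN; apply/bigsetU_finP.
    have [i hi] := selection_error_gt _ _ _ _ _ _ b0 c01 houtn hinn hN.
    by exists i => //=; rewrite -tE !mxE.
apply: (le_trans (probability_bigsetU_le _ _ _ _ _ _ _
  (K * npow n (- (m * eta)) / t `^ m) mF _)).
  by move=> i _; exact: markov_powR.
rewrite lee_fin card_ord.
have hpn' : (p n)%:R <= Cp * npow n alpha_p by apply: le_trans hpn; exact: ler_norm.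
apply: (@le_trans _ _ (Cp * npow n alpha_p * (K * npow n (- (m * eta)) / t `^ m))).
  by rewrite ler_wpM2r// divr_ge0 ?powR_ge0// mulr_ge0 ?ltW// npow_gt0.
rewrite /t powRM ?(ltW k0) ?(ltW nnb)// npowX.
have -> : - nu_b * m = - (m * nu_b) by ring.
rewrite [npow n (- (m * nu_b))]npowN npowD// npowD// invfM invrK.
by rewrite le_eqVlt; apply/orP; left; apply/eqP; field; rewrite gt_eqF.
Qed.

Lemma gamma_rate d (T : measurableType d) (R : realType) (P : probability T R)
    (p r p1 : nat -> nat) (M : forall n : nat, 'M[R]_(p1 n, p n))
    (Qm : forall n : nat, 'M[R]_(p n, r n)) (beta : forall n, 'cV[R]_(p n))
    (u : forall n, T -> 'cV[R]_(r n)) (bn : nat -> R) (m eta K C_M : R) :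
  let th := fun n => theta (Qm n) (beta n) in
  let tt := fun n w => th n + Qm n *m u n w in
  let Nn := fun n => Nset (bn n) (th n) in
  let Ms := fun n => Mset (M n) (Qm n) (Nn n) in
  0 < m -> 0 < K -> eta <= 1 / 2 ->
  (forall n (c : 'I_(r n) -> R), measurable_fun setT (fun w => \sum_(k < r n) c k * u n w k 0)) ->
  eventually_nat (fun n => forall (c : 'I_(r n) -> R) (S : R), 0 < S ->
    \sum_(k < r n) c k ^+ 2 <= S ->
    (\int[P]_w (`|\sum_(k < r n) c k * u n w k 0| `^ m)%:E
      <= (K * npow n (- (m * eta)) * S `^ (m / 2))%:E)%E) ->
  (forall e : R, 0 < e -> eventually_nat (fun n =>
    (P [set w | Nset (bn n) (tt n w) != Nn n]%classic <= e%:E)%E)) ->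
  eventually_nat (fun n => Ms n != finset.set0) ->
  eventually_nat (fun n => forall i : 'I_(p1 n), i \in Ms n ->
    \sum_(k < r n) cc (M n) (Qm n) (Nn n) i k ^+ 2 <= C_M) ->
  littleo_seq
    (fun n => maxabs (\col_(i < p1 n) \sum_(j < p n | j \notin Nn n) M n i j * th n j 0))
    (fun n => (Num.sqrt (n%:R * ln n%:R))^-1) ->
  littleo_seq
    (fun n => maxabs (M n *m theta_perp (Qm n) (beta n)))
    (fun n => (Num.sqrt (n%:R * ln n%:R))^-1) ->
  bigOp P (fun n w => maxabs (M n *m theta_hat (bn n) (tt n w) - M n *m beta n))
    (fun n => (#|Ms n|)%:R `^ (1 / m) * npow n (- eta)).
Proof.
move=> th tt Nn Ms m0 K0 eta1 mu hE hsel hMs0 hMs hoff hperp e e0.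
pose S : R := `|C_M| + 1.
have S0 : 0 < S by rewrite ltr_wpDl.
(* Chosen so that Markov's inequality at level J^(1/m) |Ms|^(1/m) n^(-eta) gives each relevant row
   the probability e / (2 |Ms|). *)
pose J := K * S `^ (m / 2) * 2 / e.
have J0 : 0 < J by rewrite divr_gt0// !mulr_gt0// powR_gt0.
pose C1 := J `^ (1 / m).
have C10 : 0 < C1 by exact: powR_gt0.
(* The 2 pays for the two deterministic terms of the decomposition. *)
exists (C1 + 2); split; first by rewrite addr_gt0.
have e2 : 0 < e / 2 by rewrite divr_gt0.
move: (eventually_and _ _ (eventually_and _ _ hE (hsel _ e2)) (eventually_and _ _
  (eventually_and _ _ hMs0 hMs) (eventually_and _ _ (eventually_and _ _ (hoff 1 ltr01) (hperp 1 ltr01))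
  (eventually_ge 4)))).
apply: eventually_mono => n [[hEn hseln] [[hMs0n hMsn] [[hoffn hperpn] n3]]].
have n0 : (0 < n)%N by exact: leq_trans n3.
have ne : 0 < npow n (- eta) by exact: npow_gt0.
have osmall : (Num.sqrt (n%:R * ln n%:R))^-1 <= npow n (- eta).
  have ln1 : 1 <= ln n%:R :> R.
    rewrite -[leLHS]expRK ler_ln ?posrE ?expR_gt0 ?ltr0n//.
    apply: (@le_trans _ _ 4); last by rewrite ler_nat.
    (* The quadratic bound gives e^(1/2) <= 2, hence e <= 4, so ln n >= 1 from n = 4 on. Then
       1/sqrt(n ln n) <= n^(-1/2) <= n^(-eta). *)
    have -> : 1 = 1 / 2 + 1 / 2 :> R by lra.
    have h : `|1 / 2 : R| <= 1 / 2 by rewrite ger0_norm// divr_ge0.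
    have := expR_le_quadratic _ _ h; have := expR_gt0 (1 / 2 : R).
    by rewrite expRD; nra.
  have sq0 : 0 < Num.sqrt (n%:R * ln n%:R) :> R.
    by rewrite sqrtr_gt0 mulr_gt0 ?ltr0n// (lt_le_trans ltr01).
  have np0 : 0 < npow n eta by exact: npow_gt0.
  rewrite npowN lef_pV2 ?posrE//.
  apply: (@le_trans _ _ (Num.sqrt n%:R)).
    by rewrite -powR12_sqrt//; apply: ler_npow => //; rewrite -[2^-1]mul1r.
  by rewrite ler_sqrt ?ler_peMr// mulr_ge0// (le_trans ler01).
set a := (#|Ms n|)%:R `^ (1 / m).
have card0 : 0 < (#|Ms n|)%:R :> R by rewrite ltr0n card_gt0.
have card1 : 1 <= (#|Ms n|)%:R :> R by rewrite ler1n card_gt0.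
have im0 : 0 <= 1 / m by rewrite divr_ge0// ltW.
(* Nonemptiness of the set of relevant rows enters here: it lets the rate absorb deterministic terms
   of order n^(-eta). *)
have a1 : 1 <= a.
  have -> : 1 = 1 `^ (1 / m) :> R by rewrite powR1.
  by rewrite ge0_ler_powR ?nnegrE.
have a0 : 0 < a by exact: lt_le_trans a1.
have tE : (C1 * (a * npow n (- eta))) `^ m = J * #|Ms n|%:R * npow n (- (m * eta)).
  rewrite powRM ?(ltW C10)// ?mulr_ge0 ?(ltW a0) ?(ltW ne)//.
  rewrite powRM ?(ltW a0) ?(ltW ne)// npowX /C1 /a -!powRrM.
  have -> : 1 / m * m = 1 by rewrite divfK// gt_eqF.
  rewrite !powRr1 ?(ltW J0) ?(ltW card0)//.
  by rewrite mulrA; congr (_ * npow _ _); ring.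
have t0 : 0 < C1 * (a * npow n (- eta)) by rewrite !mulr_gt0.
pose F i := [set w | C1 * (a * npow n (- eta)) <
  `|\sum_(k < r n) cc (M n) (Qm n) (Nn n) i k * u n w k 0|]%classic.
have mF i : measurable (F i) by exact: measurable_set_lt_norm.
have mtt i : measurable_fun setT (fun w => tt n w i 0).
  by under eq_fun do rewrite mxE [(Qm n *m _) i 0]mxE; exact: measurable_funD.
have -> : e = e / 2 + e / 2 by clear; lra.
apply: (probability_le_setU _ _ _ _ _
  [set w | Nset (bn n) (tt n w) != Nn n]%classic
  (\big[setU/set0]_(i in Ms n) F i)%classic) => //.
- apply: measurable_set_lt_norm; apply: measurable_maxabs => i.
  under eq_fun do rewrite mxE [(- (M n *m beta n)) i 0]mxE.
  by apply: measurable_funB => //; apply: measurable_mulmx_cV; exact: measurable_theta_hat.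
- exact: measurable_Nset_neq.
- by apply: bigsetU_measurable.
- move=> w /=; rewrite ger0_norm ?maxabs_ge0// => hw.
  have [hN|hN] := eqVneq (Nset (bn n) (tt n w)) (Nn n); last by left.
  right; apply/bigsetU_finP; apply: contrapT => hno.
  move: hw; apply/negP; rewrite -leNgt; apply: maxabs_le.
    by rewrite !mulr_ge0 ?addr_ge0 ?(ltW C10) ?(ltW a0) ?(ltW ne).
  move=> i; rewrite (gamma_error_decomp _ _ _ _ _ _ _ _ _ _ _ erefl hN).
  have hi1 : `|\sum_(k < r n) cc (M n) (Qm n) (Nn n) i k * u n w k 0| <= C1 * (a * npow n (- eta)).
    have [iM|iM] := boolP (i \in Ms n).
      by rewrite leNgt; apply/negP => h; apply: hno; exists i.
    (* Outside the relevant rows every c_ik vanishes, and with it the random term; hence the union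
       bound runs over [Ms n] and not over all rows. *)
    rewrite big1 ?normr0 ?(ltW t0)// => k _.
    move: iM; rewrite inE -leNgt => h.
    have /eqP : \sum_(k < r n) cc (M n) (Qm n) (Nn n) i k ^+ 2 = 0.
      by apply/eqP; rewrite eq_le h sumr_ge0// => k' _; exact: sqr_ge0.
    rewrite psumr_eq0 => [/allP /(_ k)|k' _]; last exact: sqr_ge0.
    by rewrite mem_index_enum => /(_ isT) /=; rewrite sqrf_eq0 => /eqP ->; rewrite mul0r.
  have an : npow n (- eta) <= a * npow n (- eta) by rewrite ler_peMl// ltW.
  have hi2 : `|\sum_(j < p n | j \notin Nn n) M n i j * th n j 0| <= a * npow n (- eta).
    apply: le_trans an; apply: le_trans osmall; rewrite -[leRHS]mul1r.
    apply: le_trans hoffn; apply: le_trans (ler_norm _).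
    by have := norm_le_maxabs _ _ (\col_(i < p1 n) \sum_(j < p n | j \notin Nn n) M n i j * th n j 0) i;
      rewrite mxE.
  have hi3 : `|(M n *m theta_perp (Qm n) (beta n)) i 0| <= a * npow n (- eta).
    apply: le_trans an; apply: le_trans osmall; rewrite -[leRHS]mul1r.
    apply: le_trans hperpn; apply: le_trans (ler_norm _).
    exact: norm_le_maxabs.
  apply: (le_trans (ler_normB _ _)).
  apply: (le_trans (lerD (ler_normB _ _) (lexx _))).
  rewrite [(C1 + 2) * _]mulrDl; move: hi1 hi2 hi3; clear; lra.
- apply: (le_trans (probability_bigsetU_le _ _ _ _ _ _ _ (e / 2 / #|Ms n|%:R) mF _)).
    move=> i iM; have hc := hMsn i iM.
    have hcS : \sum_(k < r n) cc (M n) (Qm n) (Nn n) i k ^+ 2 <= S.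
      by apply: (le_trans hc); rewrite /S ler_wpDr// ler_norm.
    apply: (le_trans (markov_powR _ _ _ _ _ _ _ _ (mu n _) m0 t0 (hEn _ _ S0 hcS))).
    rewrite lee_fin tE /J le_eqVlt; apply/orP; left; apply/eqP.
    have Sm0 : 0 < S `^ (m / 2) by exact: powR_gt0.
    have nm0 : 0 < npow n (- (m * eta)) by exact: npow_gt0.
    by field; rewrite !gt_eqF.
  by rewrite lee_fin mulrC divfK// gt_eqF.
Qed.

(** * The variance estimator *)

Lemma powR2 (R : realType) (x : R) : `|x| `^ 2 = x ^+ 2.
Proof. by rewrite powR_mulrn// real_normK// num_real. Qed.

Lemma integrable_dom_moment d (T : measurableType d) (R : realType) (P : probability T R)
    (X g : T -> R) (m : R) :
  measurable_fun setT X -> measurable_fun setT g ->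
  (\int[P]_w (`|X w| `^ m)%:E < +oo)%E ->
  (forall w, `|g w| <= 1 + `|X w| `^ m) -> P.-integrable setT (EFin \o g).
Proof.
move=> mX mg hX hg.
have mXm : measurable_fun setT (fun w => (`|X w| `^ m)%:E).
  by apply/measurable_EFinP; apply: (measurableT_comp (measurable_normr_powR R m)).
have iX : P.-integrable setT (fun w => (`|X w| `^ m)%:E).
  apply/integrableP; split => //.
  by under eq_integral do rewrite gee0_abs ?lee_fin ?powR_ge0//.
have h : P.-integrable setT (fun w => 1%:E + (`|X w| `^ m)%:E)%E.
  by apply: integrableD => //; exact: finite_measure_integrable_cst.
apply: le_integrable h => //; first exact/measurable_EFinP.
move=> w _ /=; rewrite lee_fin; apply: (le_trans (hg w)); exact: ler_norm.
Qed.

(** The centered squares are again i.i.d. and centered, and their second moment is finite because (x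
    - s2)^2 <= 2 x^2 + 2 s2^2 with x the squared error. *)
Lemma moment_sqr_dev d (T : measurableType d) (R : realType) (P : probability T R)
    (eps : nat -> {RV P >-> R}) :
  let s2 := fine (\int[P]_w (eps 0%N w ^+ 2)%:E)%E in
  iid_seq eps -> (\int[P]_w (`|eps 0%N w| `^ 4)%:E < +oo)%E ->
  (exists K : R, 0 < K /\ forall (n : nat) (a : 'I_n -> R) (A : R), 0 < A ->
    \sum_(i < n) a i ^+ 2 <= A ->
    (\int[P]_w (`|\sum_(i < n) a i * (eps i w ^+ 2 - s2)| `^ 2)%:E <= (K * A)%:E)%E) /\
  forall n, measurable_fun setT (fun w => \sum_(i < n) n%:R^-1 * (eps i w ^+ 2 - s2)).
Proof.
move=> s2 [indZ idZ] E4.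
have meps i : measurable_fun setT (eps i : T -> R) by exact: measurable_funPT.
have mg : measurable_fun setT (fun x : R => x ^+ 2 - s2).
  by apply: measurable_funB => //; exact: measurable_funX.
split; last first.
  move=> n; apply: measurable_sum => i; apply: measurable_funM => //.
  exact: (measurableT_comp mg).
have [Y [YE [indY idY]]] := iid_comp _ _ _ P eps _ mg indZ idZ.
have i2 : P.-integrable setT (EFin \o (fun w => eps 0%N w ^+ 2)).
  apply: (integrable_dom_moment _ _ _ P (eps 0%N) _ 4) => //; first exact: measurable_funX.
  move=> w; rewrite powR_mulrn// -[X in _ <= _ + X]normrX.
  have -> : eps 0%N w ^+ 4 = (eps 0%N w ^+ 2) ^+ 2 by ring.
  have := sqr_ge0 (eps 0%N w); set x := eps 0%N w ^+ 2 => x0.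
  by rewrite !ger0_norm ?sqr_ge0//; have := sqr_ge0 (x - 1); nra.
have i4 : P.-integrable setT (fun w => (`|eps 0%N w| `^ 4)%:E).
  apply: (integrable_dom_moment _ _ _ P (eps 0%N) _ 4) => //.
    exact: (measurableT_comp (measurable_normr_powR R 4)).
  by move=> w; rewrite ger0_norm ?powR_ge0// lerDr.
have s2E : (\int[P]_w (eps 0%N w ^+ 2)%:E = s2%:E)%E.
  by rewrite /s2 fineK// integrable_fin_num.
have EY : (\int[P]_w (Y 0%N w)%:E = 0)%E.
  under eq_integral do rewrite YE EFinB.
  rewrite integralB//; last exact: finite_measure_integrable_cst.
  by rewrite s2E integral_cst// [X in (_ - _ * X)%E]probability_setT mule1 subee.
have EY2 : (\int[P]_w (`|Y 0%N w| `^ 2)%:E < +oo)%E.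
  apply: (@le_lt_trans _ _ (\int[P]_w ((2 * s2 ^+ 2)%:E + 2%:E * (`|eps 0%N w| `^ 4)%:E))%E).
    apply: ge0_le_integral => //.
    - apply/measurable_EFinP.
      exact: (measurableT_comp (measurable_normr_powR R 2)).
    - apply: emeasurable_funD => //; apply: emeasurable_funM => //.
      by apply: (measurable_int P).
    - move=> w _; rewrite -EFinM -EFinD lee_fin powR2 YE powR_mulrn// -normrX.
      have -> : eps 0%N w ^+ 4 = (eps 0%N w ^+ 2) ^+ 2 by ring.
      rewrite ger0_norm ?sqr_ge0//.
      by set x := eps 0%N w ^+ 2; have := sqr_ge0 (x + s2); nra.
  have : P.-integrable setT (fun w => (2 * s2 ^+ 2)%:E + 2%:E * (`|eps 0%N w| `^ 4)%:E)%E.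
    apply: integrableD => //; first exact: finite_measure_integrable_cst.
    exact: integrableZl.
  move=> /integrable_fin_num h; rewrite ltey_eq h//.
have [K [K0 hK]] := moment_weighted_sum_ord _ _ _ _ _ _ (lexx 2) indY idY EY EY2.
exists K; split => // n a A A0 hA.
have e22 : 2 / 2 = 1 :> R by rewrite divff.
have := hK n a A A0 hA; rewrite e22 powRr1; last exact: ltW.
by under eq_integral do under eq_bigr do rewrite YE.
Qed.

Lemma ge0_integral_sum_finset d (T : measurableType d) (R : realType) (P : probability T R)
    (I : finType) (N : {set I}) (f : I -> T -> R) (c : R) :
  (forall i, measurable_fun setT (f i)) -> (forall i w, 0 <= f i w) ->
  (forall i, i \in N -> (\int[P]_w (f i w)%:E <= c%:E)%E) ->
  (\int[P]_w (\sum_(i in N) f i w)%:E <= (#|N|%:R * c)%:E)%E.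
Proof.
move=> mf f0 hf.
under eq_integral do rewrite -sumEFin -big_enum.
rewrite ge0_integral_sum//; last 2 first.
- by move=> i; exact/measurable_EFinP.
- by move=> i w _; rewrite lee_fin.
rewrite big_enum /= -[X in (X * _)%:E]sumr_const.
have -> : ((\sum_(i in N) 1) * c)%:E = (\sum_(i in N) c%:E)%E :> \bar R.
  by rewrite sumEFin mulr_suml; congr EFin; apply: eq_bigr => i _; rewrite mul1r.
by apply: lee_sum => i iN; exact: hf.
Qed.

(** Write tau = n^(-alpha). The lost signal g has mean square of order tau, since theta_j^2 <= b_n
    |theta_j| off the selected set; this is enough, because that mean square enters linearly and the
    product of g with the errors has variance of order 1/n. The error h enters through a cross term
    divided by tau, so its mean square has to be of order tau^2, which the bound on the size of the
    set provides. *)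
Lemma sigma_rate d (T : measurableType d) (R : realType) (P : probability T R)
    (eps : nat -> {RV P >-> R}) (p r : nat -> nat) (X : forall n : nat, 'M[R]_(n, p n))
    (beta : forall n, 'cV[R]_(p n)) (Pm : forall n : nat, 'M[R]_(n, r n))
    (lam : forall n : nat, 'rV[R]_(r n)) (Qm : forall n : nat, 'M[R]_(p n, r n))
    (u : forall n, T -> 'cV[R]_(r n)) (bn : nat -> R) (eta K C_lam C_b nu_b c_b alpha : R) :
  let th := fun n => theta (Qm n) (beta n) in
  let tt := fun n w => th n + Qm n *m u n w in
  let Nn := fun n => Nset (bn n) (th n) in
  let y := fun n w => yvec (X n) (beta n) (epsvec eps n w) in
  let s2 := fine (\int[P]_w (eps 0%N w ^+ 2)%:E)%E in
  (forall n, is_thin_svd (X n) (Pm n) (lam n) (Qm n)) ->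
  0 < K -> 0 < C_lam -> eta <= 1 / 2 -> 0 < alpha <= eta ->
  iid_seq eps -> (\int[P]_w (eps 0%N w)%:E = 0)%E ->
  (\int[P]_w (`|eps 0%N w| `^ 2)%:E < +oo)%E ->
  (\int[P]_w (`|eps 0%N w| `^ 4)%:E < +oo)%E ->
  eventually_nat (fun n => forall k : 'I_(r n), lam n 0 k <= C_lam * npow n (1 / 2)) ->
  (forall n (c : 'I_(r n) -> R), measurable_fun setT (fun w => \sum_(k < r n) c k * u n w k 0)) ->
  eventually_nat (fun n => forall (c : 'I_(r n) -> R) (S : R), 0 < S ->
    \sum_(k < r n) c k ^+ 2 <= S ->
    (\int[P]_w (`|\sum_(k < r n) c k * u n w k 0| `^ 2)%:E
      <= (K * npow n (- (2 * eta)) * S `^ (2 / 2))%:E)%E) ->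
  (forall e : R, 0 < e -> eventually_nat (fun n =>
    (P [set w | Nset (bn n) (tt n w) != Nn n]%classic <= e%:E)%E)) ->
  0 < C_b -> eventually_nat (fun n => bn n = C_b * npow n (- nu_b)) -> 0 < c_b < 1 ->
  eventually_nat (fun n => forall i : 'I_(p n),
      i \notin Nn n -> `|th n i 0| <= c_b * bn n) ->
  bigO_seq (fun n => npow n (- nu_b) * \sum_(j < p n | j \notin Nn n) `|th n j 0|)
    (fun n => npow n (- alpha)) ->
  bigO_seq (fun n => Num.sqrt (#|Nn n|)%:R / npow n eta) (fun n => npow n (- alpha)) ->
  bigOp P (fun n w => `|sigma2_hat (X n) (y n w) (theta_hat (bn n) (tt n w)) - s2|)
    (fun n => npow n (- alpha)).
Proof.
move=> th tt Nn y s2 svd K0 CL0 eta1 /andP[al0 aleta] iid EZ E2 E4 hlam mu hE hsel Cb0 hbn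
  /andP[cb0 cb1] hout [C5 [C50 h5]] [C6 [C60 h6]] e e0.
have [[K3 [K30 hK3]] mS1] := moment_sqr_dev _ _ _ _ _ iid E4.
have [K2 [K20 hK2]] := moment_weighted_sum_ord _ _ _ _ _ _ (lexx 2) iid.1 iid.2 EZ E2.
pose Cg := C_lam ^+ 2 * (C_b * C5).
have CL2 : 0 < C_lam ^+ 2 by rewrite exprn_gt0.
have Cg0 : 0 < Cg by rewrite !mulr_gt0.
pose J := K3 + K2 * Cg + K * C6 ^+ 2.
have J0 : 0 < J by rewrite !addr_gt0// mulr_gt0// exprn_gt0.
(* [J] dominates the constants of the three Markov bounds. A first-moment bound yields J / C0 and a
   second-moment bound J / C0^2; both are at most e/4 because C0 is at least 1 and at least J /
   (e/4). *)
pose C0 := 1 + J / (e / 4).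
have JC : J / C0 <= e / 4.
  have C00 : 0 < C0 by rewrite addr_gt0// divr_gt0// divr_gt0.
  have e4 : 0 < e / 4 by rewrite divr_gt0.
  by rewrite ler_pdivrMr// /C0 mulrDr mulr1 (mulrC _ (J / _)) divfK ?gt_eqF// lerDr ltW.
have C01 : 1 <= C0 by rewrite /C0 lerDl divr_ge0 ?(ltW J0)// divr_ge0// ltW.
have C00 : 0 < C0 by lra.
have JC2 : J / C0 ^+ 2 <= e / 4.
  apply: le_trans JC; rewrite ler_pM2l// lef_pV2 ?posrE ?exprn_gt0//.
  by rewrite expr2 ler_peMl// ltW.
(* These are the coefficients of [sqr_dev_le]: 3 + 2 for the two random sums, 3 for g, 2 for the
   AM-GM weight, and 2 for h. *)
pose Cf := 5 * C0 + 3 * Cg + 2 * `|s2| + 2 * (C_lam ^+ 2 * C0).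
have Cf0 : 0 < Cf.
  have h1 : 0 <= `|s2| by [].
  have h2 : 0 < C_lam ^+ 2 * C0 by rewrite mulr_gt0.
  rewrite /Cf; lra.
exists Cf; split => //.
have e4 : 0 < e / 4 by rewrite divr_gt0.
move: (eventually_and _ _ (eventually_and _ _ (eventually_and _ _ hlam hE) (hsel _ e4))
  (eventually_and _ _ (eventually_and _ _ hbn hout)
  (eventually_and _ _ (eventually_and _ _ h5 h6) (eventually_ge 1)))).
apply: eventually_mono => n [[[hlamn hEn] hseln] [[hbnn houtn] [[h5n h6n] n0]]].
set tau := npow n (- alpha).
have nR0 : 0 < (n%:R : R) by rewrite ltr0n.
have tau0 : 0 < tau by exact: npow_gt0.
have tau1 : tau <= 1 by rewrite -(npow0 R n); apply: ler_npow => //; rewrite oppr_le0 ltW.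
(* Since alpha <= eta <= 1/2, averages with variance of order 1/n deviate by at most the order of
   tau. *)
have ntau : n%:R^-1 <= tau ^+ 2.
  by rewrite /tau npow_sqr -(npow1 R n) -npowN; apply: ler_npow => //; lra.
pose f : 'cV[R]_(p n) := \col_j (if j \in Nn n then 0 else th n j 0).
pose g i := (X n *m f) i 0.
pose v w : 'cV[R]_(p n) := \col_j (if j \in Nn n then (Qm n *m u n w) j 0 else 0).
pose h w i := (X n *m v w) i 0.
pose H w := \sum_(j in Nn n) (Qm n *m u n w) j 0 ^+ 2.
pose S1 w := \sum_(i < n) n%:R^-1 * (eps i w ^+ 2 - s2).
pose S2 w := \sum_(i < n) n%:R^-1 * g i * eps i w.
have lam2 : n%:R^-1 * (C_lam * npow n (1 / 2)) ^+ 2 = C_lam ^+ 2.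
  rewrite exprMn npow_sqr; have -> : 2 * (1 / 2) = 1 :> R by field.
  by rewrite npow1 mulrCA mulVf ?mulr1// gt_eqF.
have bn0 : 0 < bn n by rewrite hbnn mulr_gt0// npow_gt0.
have hg : n%:R^-1 * \sum_(i < n) g i ^+ 2 <= Cg * tau.
  have := design_sqr_le _ _ _ _ _ _ _ _ f _ (svd n) hlamn.
  have ni : 0 <= n%:R^-1 :> R by rewrite invr_ge0 ltW.
  move=> /(ler_wpM2l ni) /le_trans; apply; rewrite mulrA lam2 /Cg -mulrA ler_pM2l//.
  apply: (@le_trans _ _ (bn n * \sum_(j < p n | j \notin Nn n) `|th n j 0|)).
    rewrite mulr_sumr [leRHS]big_mkcond /=; apply: ler_sum => j _.
    rewrite mxE; have [jN|jN] := boolP (j \in Nn n); first by rewrite expr0n.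
    rewrite /= -(real_normK (num_real (th n j 0))) expr2 ler_wpM2r//.
    by apply: (le_trans (houtn j jN)); rewrite ler_piMl ?(ltW bn0)// ltW.
  rewrite hbnn -!mulrA ler_pM2l//; apply: le_trans h5n; exact: ler_norm.
have mQu j : measurable_fun setT (fun w => (Qm n *m u n w) j 0).
  by under eq_fun do rewrite mxE; exact: mu.
have mQu2 j : measurable_fun setT (fun w => (Qm n *m u n w) j 0 ^+ 2) by exact: measurable_funX.
have mtt i : measurable_fun setT (fun w => tt n w i 0).
  by under eq_fun do rewrite mxE; exact: measurable_funD.
have mH : measurable_fun setT H.
  rewrite /H; under eq_fun do rewrite -big_enum; exact: measurable_sum.
have mS2 : measurable_fun setT S2.
  by apply: measurable_sum => i; apply: measurable_funM => //; exact: measurable_funPT.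
have H0 w : 0 <= H w by apply: sumr_ge0 => j _; exact: sqr_ge0.
have hh w : n%:R^-1 * \sum_(i < n) h w i ^+ 2 <= C_lam ^+ 2 * H w.
  have := design_sqr_le _ _ _ _ _ _ _ _ (v w) _ (svd n) hlamn.
  have ni : 0 <= n%:R^-1 :> R by rewrite invr_ge0 ltW.
  move=> /(ler_wpM2l ni) /le_trans; apply; rewrite mulrA lam2 ler_pM2l//.
  rewrite /H [leRHS]big_mkcond /=; apply: ler_sum => j _.
  by rewrite mxE; case: (j \in Nn n); [exact: lexx|rewrite expr0n].
pose A0 := [set w | Nset (bn n) (tt n w) != Nn n]%classic.
pose A1 := [set w | C0 * tau < `|S1 w|]%classic.
pose A2 := [set w | C0 * tau < `|S2 w|]%classic.
pose A3 := [set w | C0 * tau ^+ 2 < `|H w|]%classic.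
have mA0 : measurable A0 by exact: measurable_Nset_neq.
have mA1 : measurable A1 by apply: measurable_set_lt_norm; exact: mS1.
have mA2 : measurable A2 by exact: measurable_set_lt_norm.
have mA3 : measurable A3 by exact: measurable_set_lt_norm.
have C0t : 0 < C0 * tau by exact: mulr_gt0.
have C0t2 : 0 < C0 * tau ^+ 2 by rewrite mulr_gt0// exprn_gt0.
have p2 : 0 < 2 :> R by [].
have [J1 [J2 J3]] : K3 <= J /\ K2 * Cg <= J /\ K * C6 ^+ 2 <= J.
  have h2 : 0 < K2 * Cg by rewrite mulr_gt0.
  have h3 : 0 < K * C6 ^+ 2 by rewrite mulr_gt0// exprn_gt0.
  by rewrite /J; clear -h2 h3 K30; split; [|split]; lra.
have nV0 : 0 < n%:R^-1 :> R by rewrite invr_gt0.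
have tail2 (B : R) : 0 <= B -> B <= J -> B * n%:R^-1 / (C0 * tau) `^ 2 <= e / 4.
  move=> B0 BJ; rewrite powR_mulrn ?(ltW C0t)//.
  apply: le_trans JC2; rewrite ler_pdivrMr ?exprn_gt0//.
  have -> : J / C0 ^+ 2 * (C0 * tau) ^+ 2 = J * tau ^+ 2 by field; rewrite gt_eqF.
  by apply: ler_pM => //; exact: ltW.
have PA1 : (P A1 <= (e / 4)%:E)%E.
  have hA : \sum_(i < n) (n%:R^-1 : R) ^+ 2 <= n%:R^-1.
    by rewrite sumr_const card_ord -[_ *+ n]mulr_natl expr2 mulVKf ?gt_eqF.
  have := markov_powR _ _ _ _ _ _ _ _ (mS1 n) p2 C0t (hK3 n (fun=> n%:R^-1) _ nV0 hA).
  move=> /le_trans; apply; rewrite lee_fin; apply: tail2 => //; exact: ltW.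
have PA2 : (P A2 <= (e / 4)%:E)%E.
  have Cgn : 0 < Cg * n%:R^-1 by exact: mulr_gt0.
  have hA : \sum_(i < n) (n%:R^-1 * g i) ^+ 2 <= Cg * n%:R^-1.
    under eq_bigr do rewrite exprMn.
    rewrite -mulr_sumr expr2 -mulrA mulrC ler_pM2r//.
    by apply: (le_trans hg); rewrite ler_piMr// ltW.
  have := markov_powR _ _ _ _ _ _ _ _ mS2 p2 C0t (hK2 n (fun i => n%:R^-1 * g i) _ Cgn hA).
  move=> /le_trans; apply; rewrite lee_fin divff// powRr1 ?(ltW Cgn)// mulrA.
  by apply: tail2 => //; rewrite mulr_ge0 ?ltW.
have PA3 : (P A3 <= (e / 4)%:E)%E.
  (* [H] is already a sum of squares, so Markov is applied to its first moment: one second moment of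
     a coordinate for each selected index. *)
  have hH : (\int[P]_w (`|H w| `^ 1)%:E <= (#|Nn n|%:R * (K * npow n (- (2 * eta))))%:E)%E.
    under eq_integral do rewrite powRr1// ger0_norm//.
    apply: ge0_integral_sum_finset => //.
      by move=> i w; exact: sqr_ge0.
    move=> i _; have := hEn (fun k => Qm n i k) 1 ltr01.
    have [_ _ QQ _ _] := svd n.
    move=> /(_ (sum_sqr_row_orthonormal_le1 _ _ _ _ i QQ)); rewrite powR1 mulr1.
    by under [in X in _ -> X]eq_integral do rewrite mxE -powR2.
  have := markov_powR _ _ _ _ _ _ _ _ mH ltr01 C0t2 hH.
  move=> /le_trans; apply; rewrite lee_fin powRr1 ?(ltW C0t2)//.
  have hN : #|Nn n|%:R * npow n (- (2 * eta)) <= C6 ^+ 2 * tau ^+ 2.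
    have := h6n; rewrite ger0_norm ?divr_ge0 ?sqrtr_ge0 ?powR_ge0// => h6'.
    have -> : #|Nn n|%:R * npow n (- (2 * eta)) = (Num.sqrt #|Nn n|%:R / npow n eta) ^+ 2.
      by rewrite exprMn sqr_sqrtr// exprVn npow_sqr -npowN.
    by rewrite -exprMn lerXn2r ?nnegrE ?divr_ge0 ?sqrtr_ge0 ?powR_ge0// mulr_ge0 ?ltW.
  apply: le_trans JC; rewrite ler_pdivrMr//.
  have -> : J / C0 * (C0 * tau ^+ 2) = J * tau ^+ 2 by field; rewrite gt_eqF.
  rewrite mulrCA; apply: (@le_trans _ _ (K * (C6 ^+ 2 * tau ^+ 2))); first by rewrite ler_pM2l.
  by rewrite mulrA ler_wpM2r// sqr_ge0.
have -> : e = e / 4 + (e / 4 + (e / 4 + e / 4)) by clear; lra.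
apply: (probability_le_setU _ _ _ _ _ A0 (A1 `|` (A2 `|` A3))%classic) => //.
- apply: measurable_set_lt_norm; apply: measurableT_comp => //.
  apply: measurable_funB => //; apply: measurable_sigma2_hat; last exact: measurable_theta_hat.
  move=> i; under eq_fun do rewrite mxE [epsvec _ _ _ _ _]mxE.
  by apply: measurable_funD => //; exact: measurable_funPT.
- by apply: measurableU => //; exact: measurableU.
- move=> w /=; rewrite normr_id => hw.
  have [hN|hN] := eqVneq (Nset (bn n) (tt n w)) (Nn n); last by left.
  right; apply: contrapT => hno.
  have hS1 : `|S1 w| <= C0 * tau by rewrite leNgt; apply/negP => hlt; apply: hno; left.
  have hS2 : `|S2 w| <= C0 * tau by rewrite leNgt; apply/negP => hlt; apply: hno; right; left.
  have hH : H w <= C0 * tau ^+ 2.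
    by rewrite -(ger0_norm (H0 w)) leNgt; apply/negP => hlt; apply: hno; right; right.
  move: hw; apply/negP; rewrite -leNgt /sigma2_hat.
  have rE i : y n w i 0 - (X n *m theta_hat (bn n) (tt n w)) i 0 = eps i w + g i - h w i.
    rewrite (residual_decomp _ _ _ _ _ _ _ _ _ _ (Qm n *m u n w) _ _ i (svd n) erefl hN).
    by rewrite /g /h mxE.
  under eq_bigr do rewrite rE.
  have t01 : 0 < tau <= 1 by rewrite tau0.
  apply: (le_trans (sqr_dev_le _ n (fun i => eps i w) g (h w) s2 tau n0 t01)).
  have hh2 : 2 / tau * (n%:R^-1 * \sum_(i < n) h w i ^+ 2) <= 2 * (C_lam ^+ 2 * C0) * tau.
    have -> : 2 * (C_lam ^+ 2 * C0) * tau = 2 / tau * (C_lam ^+ 2 * (C0 * tau ^+ 2)).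
      by field; rewrite gt_eqF.
    rewrite ler_pM2l ?divr_gt0//; apply: (le_trans (hh w)); by rewrite ler_pM2l.
  rewrite -/(S1 w) -/(S2 w).
  have -> : Cf * tau = 3 * (C0 * tau) + 2 * (C0 * tau) + 3 * (Cg * tau) + 2 * tau * `|s2|
     + 2 * (C_lam ^+ 2 * C0) * tau by rewrite /Cf; ring.
  move: hS1 hS2 hg hh2; clear; lra.
- apply: (probability_le_setU _ _ _ _ _ A1 (A2 `|` A3)%classic) => //.
  + by apply: measurableU => //; exact: measurableU.
  + exact: measurableU.
  + by apply: (probability_le_setU _ _ _ _ _ A2 A3) => //; exact: measurableU.
Qed.

(** * Lower moments of the errors and assembly of the two claims *)

Lemma moment_lt_pinfty_le d (T : measurableType d) (R : realType) (P : probability T R)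
    (X : {RV P >-> R}) (q m : R) : 0 <= q -> q <= m ->
  (\int[P]_w (`|X w| `^ m)%:E < +oo)%E -> (\int[P]_w (`|X w| `^ q)%:E < +oo)%E.
Proof.
move=> q0 qm hX.
have mX : measurable_fun setT (X : T -> R) by exact: measurable_funPT.
have : P.-integrable setT (EFin \o (fun w => `|X w| `^ q)).
  apply: (integrable_dom_moment _ _ _ P X _ m) => //.
    exact: (measurableT_comp (measurable_normr_powR R q)).
  move=> w; rewrite ger0_norm ?powR_ge0//; have := powR_ge0 `|X w| m => h.
  have [x1|x1] := leP `|X w| 1.
    have : `|X w| `^ q <= 1 `^ q by rewrite ge0_ler_powR ?nnegrE.
    by rewrite powR1; lra.
  by have := ler_powR (ltW x1) qm; lra.
by move=> /integrable_fin_num h; rewrite ltey_eq h.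
Qed.

Theorem theorem1
  (R : realType) (d : measure_display) (T : measurableType d) (P : probability T R)
  (eps : nat -> {RV P >-> R})
  (p r p1 : nat -> nat)
  (X : forall n : nat, 'M[R]_(n, p n))
  (beta : forall n : nat, 'cV[R]_(p n))
  (M : forall n : nat, 'M[R]_(p1 n, p n))
  (Pm : forall n : nat, 'M[R]_(n, r n))
  (lam : forall n : nat, 'rV[R]_(r n))
  (Qm : forall n : nat, 'M[R]_(p n, r n))
  (rho bn : nat -> R)
  (c_lam C_lam eta alpha_theta delta m alpha_p C_b nu_b c_b alpha_M c_M C_M alpha_sigma : R) :
  let th := fun n => theta (Qm n) (beta n) in
  let Nn := fun n => Nset (bn n) (th n) in
  let Ms := fun n => Mset (M n) (Qm n) (Nn n) in
  let y := fun n w => yvec (X n) (beta n) (epsvec eps n w) in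
  let tt := fun n w => theta_tilde (X n) (lam n) (Qm n) (rho n) (y n w) in
  let Nhat := fun n w => Nset (bn n) (tt n w) in
  let gamma_hat := fun n w => M n *m theta_hat (bn n) (tt n w) in
  let gamma := fun n => M n *m beta n in
  let sigma2 := fine ('E_P[fun w => (eps 0%N w ^+ 2)%R])%E in
  (* design: rank r, thin SVD *)
  (forall n, \rank (X n) = r n) ->
  (forall n, is_thin_svd (X n) (Pm n) (lam n) (Qm n)) ->
  (* Assumption 1 *)
  0 < c_lam -> 0 < C_lam -> 0 < eta <= 1 / 2 ->
  eventually_nat (fun n => forall k : 'I_(r n),
      c_lam * npow n eta <= lam n 0 k /\ lam n 0 k <= C_lam * npow n (1 / 2)) ->
  bigO_seq (fun n => Num.sqrt (\sum_(i < p n) (th n i 0) ^+ 2)) (fun n => npow n alpha_theta) ->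
  0 < alpha_theta < 3 * eta ->
  (* Assumption 2 *)
  (forall n, 0 < rho n) ->
  bigO_seq rho (fun n => npow n (2 * eta - delta)) ->
  (eta + alpha_theta) / 2 < delta < 2 * eta ->
  (* Assumption 3 *)
  iid_seq eps ->
  ('E_P[eps 0%N] = 0)%E ->
  4 < m ->
  ('E_P[fun w => (`|eps 0%N w| `^ m)%R] < +oo)%E ->
  (* Assumption 4 *)
  bigO_seq (fun n => (p n)%:R) (fun n => npow n alpha_p) ->
  0 <= alpha_p < m * eta ->
  0 < C_b -> 0 < nu_b ->
  eventually_nat (fun n => bn n = C_b * npow n (- nu_b)) ->
  nu_b + alpha_p / m - eta < 0 ->
  0 < c_b < 1 ->
  eventually_nat (fun n => forall i : 'I_(p n),
      i \notin Nn n -> `|th n i 0| <= c_b * bn n) ->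
  eventually_nat (fun n => forall i : 'I_(p n),
      i \in Nn n -> bn n / c_b <= `|th n i 0|) ->
  (* Assumption 5 *)
  eventually_nat (fun n => Ms n != finset.set0) ->
  bigO_seq (fun n => (#|Ms n|)%:R) (fun n => npow n alpha_M) ->
  alpha_M < m * eta ->
  0 < c_M ->
  eventually_nat (fun n => forall i : 'I_(p1 n), i \in Ms n ->
      c_M < \sum_(k < r n) cc (M n) (Qm n) (Nn n) i k ^+ 2 <= C_M) ->
  littleo_seq
    (fun n => maxabs (\col_(i < p1 n) \sum_(j < p n | j \notin Nn n) M n i j * th n j 0))
    (fun n => (Num.sqrt (n%:R * ln n%:R))^-1) ->
  littleo_seq
    (fun n => maxabs (M n *m theta_perp (Qm n) (beta n)))
    (fun n => (Num.sqrt (n%:R * ln n%:R))^-1) ->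
  (* conclusions *)
  (bigO_seq (fun n => fine (P [set w | Nhat n w != Nn n]%classic))
            (fun n => npow n (alpha_p + m * nu_b - m * eta))
   /\ bigOp P (fun n w => maxabs (gamma_hat n w - gamma n))
              (fun n => (#|Ms n|)%:R `^ (1 / m) * npow n (- eta)))
  /\
  ((* Assumption 6 *)
   0 < alpha_sigma <= eta ->
   bigO_seq (fun n => npow n (- nu_b) * \sum_(j < p n | j \notin Nn n) `|th n j 0|)
            (fun n => npow n (- alpha_sigma)) ->
   bigO_seq (fun n => Num.sqrt (#|Nn n|)%:R / npow n eta)
            (fun n => npow n (- alpha_sigma)) ->
   bigOp P (fun n w => `|sigma2_hat (X n) (y n w) (theta_hat (bn n) (tt n w)) - sigma2|)
           (fun n => npow n (- alpha_sigma))).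
Proof.
move=> th Nn Ms y tt Nhat gamma_hat gamma sigma2 _ svd c0 CL0 /andP[eta0 eta1] hlam hth _ rho0 hrho
  /andP[hd _] iid EZ m4 Em hp /andP[ap0 apm] Cb0 nb0 hb hnb cb hout hin hMs0 _ _ cM0 hMs hoff hperp.
rewrite unlock in EZ; rewrite unlock in Em.
have m0 : 0 < m by lra.
have hlam1 : eventually_nat (fun n => forall k : 'I_(r n), c_lam * npow n eta <= lam n 0 k).
  by apply: eventually_mono hlam => n h k; case: (h k).
have hlam2 : eventually_nat (fun n => forall k : 'I_(r n), lam n 0 k <= C_lam * npow n (1 / 2)).
  by apply: eventually_mono hlam => n h k; case: (h k).
have [C [C0 hrate]] := ridge_rates _ _ _ _ _ _ _ _ _ _ _ _ _ svd c0 hlam1 hth rho0 hrho hd.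
have E2 : (\int[P]_w (`|eps 0%N w| `^ 2)%:E < +oo)%E.
  by apply: moment_lt_pinfty_le Em; lra.
have E4 : (\int[P]_w (`|eps 0%N w| `^ 4)%:E < +oo)%E.
  by apply: moment_lt_pinfty_le Em; lra.
have m2 : 2 <= m by lra.
have [K [K0 hK]] := ridge_error_moment_rate _ _ _ _ _ _ _ _ _ _ _ _ _ _ _ m2 iid EZ Em C0 hrate.
have [K2 [K20 hK2]] :=
  ridge_error_moment_rate _ _ _ _ _ _ _ _ _ _ _ _ _ _ _ (lexx 2) iid EZ E2 C0 hrate.
pose u n w := ridge_error (Pm n) (lam n) (Qm n) (rho n) (beta n) (epsvec eps n w).
have ttE : tt = fun n w => th n + Qm n *m u n w.
  apply: functional_extensionality_dep => n; apply/funext => w; exact: theta_tildeE.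
have mu n (c : 'I_(r n) -> R) : measurable_fun setT (fun w => \sum_(k < r n) c k * u n w k 0).
  exact: measurable_ridge_error_dot.
have mtt n i : measurable_fun setT (fun w => tt n w i 0).
  rewrite ttE; under eq_fun do rewrite mxE [(Qm n *m _) i 0]mxE.
  by apply: measurable_funD => //; exact: mu.
have hE : eventually_nat (fun n => forall i : 'I_(p n),
    (\int[P]_w (`|(tt n w - th n) i 0| `^ m)%:E <= (K * npow n (- (m * eta)))%:E)%E).
  apply: eventually_mono hK => n h i; have [_ _ QQ _ _] := svd n.
  have := h _ _ ltr01 (sum_sqr_row_orthonormal_le1 _ _ _ _ i QQ); rewrite powR1 mulr1.
  by under [in X in _ -> X]eq_integral do rewrite ttE addrC addKr mxE.
have [Cs [Cs0 hCs]] := selection_rate _ _ _ _ _ _ _ _ _ _ _ _ _ _ _ m0 K0 mtt hE hp Cb0 hb cb hout hin.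
have hsel e : 0 < e -> eventually_nat (fun n =>
    (P [set w | Nset (bn n) (tt n w) != Nn n]%classic <= e%:E)%E).
  (* The exponent of the selection bound is m times the quantity assumed negative, so the bound
     tends to 0; the other two claims use the selection result only in this form. *)
  move=> e0; have x0 : 0 < - (alpha_p + m * nu_b - m * eta).
    have : m * (nu_b + alpha_p / m - eta) < 0 by rewrite pmulr_rlt0.
    by rewrite mulrBr mulrDr mulrCA divff ?gt_eqF// mulr1; lra.
  have d0 : 0 < e / Cs by rewrite divr_gt0.
  apply: eventually_mono (eventually_and _ _ hCs (npow_small _ _ _ x0 d0)) => n [h1 h2].
  apply: (le_trans h1); rewrite lee_fin.
  by move: h2; rewrite opprK ler_pdivlMr// mulrC.
split; first split.
- exists Cs; split => //; apply: eventually_mono hCs => n h.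
  have mN : measurable [set w | Nhat n w != Nn n]%classic by exact: measurable_Nset_neq.
  by rewrite ger0_norm ?fine_ge0// -lee_fin fineK ?fin_num_measure.
- have hMs' : eventually_nat (fun n => forall i : 'I_(p1 n), i \in Ms n ->
      \sum_(k < r n) cc (M n) (Qm n) (Nn n) i k ^+ 2 <= C_M).
    by apply: eventually_mono hMs => n h i /h /andP[].
  rewrite ttE in hsel; rewrite /gamma_hat ttE.
  exact: (gamma_rate _ _ _ _ _ _ _ _ _ _ _ _ _ _ _ _ m0 K0 eta1 mu hK hsel hMs0 hMs' hoff hperp).
- move=> halpha h5 h6; rewrite /sigma2 unlock.
  rewrite ttE in hsel; rewrite ttE.
  exact: (sigma_rate _ _ _ _ _ _ _ _ _ _ _ _ _ _ _ _ _ _ _ _ _ svd K20 CL0 eta1 halpha iid EZ E2 E4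
    hlam2 mu hK2 hsel Cb0 hb cb hout h5 h6).
Qed.
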